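(* For every signed graph $\Sigma$, the number of totally cyclic orientations of $\Sigma$ equals $(-1)^{\xi(\Sigma)}\bar\phi_\Sigma(-1)$.
   Context: A signed graph $\Sigma=(\Gamma,\sigma)$ is a finite graph $\Gamma=(V,E)$, whose edges may be links (two distinct endpoints), loops (two coinciding endpoints), halfedges (one end, one endpoint) and loose edges (no ends, no endpoints), multiple edges allowed, together with a function $\sigma$ from the set of links and loops to $\{+,-\}$. The sign of a circle (connected 2-regular subgraph, including loops) is the product of the signs of its edges. A subgraph is balanced if it contains no halfedges and all its circles are positive. For $T\subseteq E$, $\Sigma|T$ is the spanning subgraph with edge set $T$, and $b(\Sigma|T)$ is the number of its connected components that are balanced (isolated nodes count as balanced; loose edges are ignored). The bias matroid $G(\Sigma)$ is the matroid on $E$ with rank function $r(T)=|V|-b(\Sigma|T)$. The cyclomatic number is $\xi(\Sigma)=|E|-|V|+b(\Sigma)$. An orientation of $\Sigma$ is a function $\eta$ from edge ends to $\{+1,-1\}$ ($+1$ meaning the arrow on that end points into the incident node, $-1$ that it points out) such that each link or loop $e$ with ends $\epsilon_1,\epsilon_2$ satisfies $\sigma(e)=-\eta(\epsilon_1)\eta(\epsilon_2)$. Every edge has exactly two orientations, opposite to each other (by convention this includes loose edges). A cycle in an oriented signed graph is a circuit of $G(\Sigma)$ such that no node has all arrows (of the edges of the circuit) pointing into it or all arrows pointing out of it (a loose edge by itself is a circuit and is a cycle in either orientation). An orientation is totally cyclic if every edge belongs to a cycle. The incidence matrix $\mathrm{H}(\Sigma)=(\eta(v,e))_{V\times E}$,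 for a fixed orientation $\eta$, has $\eta(v,e)$ equal to the sum of $\eta(\epsilon)$ over all ends $\epsilon$ of $e$ incident to $v$. A flow with values in an abelian group $A$ is an $x\in A^E$ with $\mathrm{H}(\Sigma)x=0$; it is nowhere-zero if $x(e)\ne0$ for all $e$. $\bar\phi_\Sigma$ is the modular flow polynomial: the polynomial such that $\bar\phi_\Sigma(|A|)$ is the number of nowhere-zero $A$-flows on $\Sigma$ for every finite abelian group $A$ of odd order; explicitly $\bar\phi_\Sigma(k)=(-1)^{\xi(\Sigma)}t_{G(\Sigma)}(0,1-k)$, with $t$ the Tutte polynomial. *)

(* Defs.v *)
From HB Require Import structures.
From mathcomp Require Import all_boot all_order all_algebra.

Set Implicit Arguments.
Unset Strict Implicit.
Unset Printing Implicit Defensive.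

Import GRing.Theory Num.Theory.
Local Open Scope ring_scope.

(* Signs are booleans: [true] is +1 and [false] is -1. *)
Definition pm (s : bool) : int := if s then 1 else -1.

(* [TwoEnded u v s] is an edge of sign s with two ends: a link if u and v are
   distinct, a loop if u = v.  Halfedges and loose edges carry no sign. *)
Inductive edge_kind (V : Type) : Type :=
| TwoEnded of V & V & bool
| Halfedge of V
| LooseEdge.
Arguments LooseEdge {V}.

Definition signed_graph (V E : finType) : Type := E -> edge_kind V.

Section SignedGraph.
Variables (V E : finType) (S : signed_graph V E).

(* The possible ends of e are numbered by booleans; the value is [None] when
   the end does not exist. *)
Definition endpoint (e : E) (i : bool) : option V :=
  match S e with
  | TwoEnded u v _ => Some (if i then v else u)
  | Halfedge u => if i then None else Some u
  | LooseEdge => None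
  end.

Definition is_two_ended (e : E) : bool :=
  if S e is TwoEnded _ _ _ then true else false.
Definition is_halfedge (e : E) : bool :=
  if S e is Halfedge _ then true else false.
Definition is_loose (e : E) : bool :=
  if S e is LooseEdge then true else false.

(* The value 1 on halfedges and loose edges is a placeholder: [edge_sign] is
   only ever used on links and loops. *)
Definition edge_sign (e : E) : int :=
  if S e is TwoEnded _ _ s then pm s else 1.

Definition edge_end : finType := {p : E * bool | endpoint p.1 p.2 != None}.
Definition end_edge (h : edge_end) : E := (val h).1.
Definition end_at (v : V) (h : edge_end) : bool :=
  endpoint (val h).1 (val h).2 == Some v.

(* Number of ends of edges of T at v: a loop contributes 2. *)
Definition degree (T : {set E}) (v : V) : nat :=
  #|[set h : edge_end | (end_edge h \in T) && end_at v h]|.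

Definition adj (T : {set E}) : rel V := fun u v =>
  [exists e in T, exists i, (endpoint e i == Some u)
                            && (endpoint e (~~ i) == Some v)].

(* Circles, given by their edge sets. *)
Definition circle (C : {set E}) : bool :=
  [&& C != set0,
      [forall e in C, is_two_ended e],
      [forall v, (0 < degree C v)%N ==> (degree C v == 2)%N]
    & [forall u, forall v, (0 < degree C u)%N && (0 < degree C v)%N
                           ==> connect (adj C) u v]].

Definition circle_sign (C : {set E}) : int := \prod_(e in C) edge_sign e.

Definition balanced (T : {set E}) : bool :=
  [forall e in T, ~~ is_halfedge e]
  && [forall C : {set E}, (C \subset T) && circle C ==> (circle_sign C == 1)].

(* The node sets of the connected components of the spanning subgraph with
   edge set T; loose edges belong to no component. *)
Definition components (T : {set E}) : {set {set V}} :=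
  equivalence_partition (connect (adj T)) [set: V].

Definition component_edges (T : {set E}) (K : {set V}) : {set E} :=
  [set e in T | [exists i, exists v in K, endpoint e i == Some v]].

Definition nb_balanced (T : {set E}) : nat :=
  #|[set K in components T | balanced (component_edges T K)]|.

Definition bias_rank (T : {set E}) : nat := (#|V| - nb_balanced T)%N.

Definition bias_circuit (C : {set E}) : bool :=
  minset (fun T : {set E} => (bias_rank T < #|T|)%N) C.

Definition cyclomatic : int := #|E|%:Z - #|V|%:Z + (nb_balanced [set: E])%:Z.

(* The first component gives the arrow of each end ([true], i.e. +1, points
   into the node).  The second one implements the convention that a loose
   edge, which has no end, nevertheless has two orientations. *)
Definition arrows : finType :=
  ({ffun edge_end -> bool} * {ffun {e : E | is_loose e} -> bool})%type.

Definition is_orientation (o : arrows) : bool :=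
  [forall h1, forall h2, (h1 != h2) && (end_edge h1 == end_edge h2) ==>
    (edge_sign (end_edge h1) == - (pm (o.1 h1) * pm (o.1 h2)))].

Definition is_source_or_sink (o : arrows) (C : {set E}) (v : V) : bool :=
  (0 < degree C v)%N &&
  ([forall h, (end_edge h \in C) && end_at v h ==> o.1 h]
   || [forall h, (end_edge h \in C) && end_at v h ==> ~~ o.1 h]).

Definition oriented_cycle (o : arrows) (C : {set E}) : bool :=
  bias_circuit C && [forall v, ~~ is_source_or_sink o C v].

Definition totally_cyclic (o : arrows) : bool :=
  [forall e, exists C : {set E}, (e \in C) && oriented_cycle o C].

Definition totally_cyclic_orientations : {set arrows} :=
  [set o | is_orientation o && totally_cyclic o].

Definition incidence (o : arrows) (v : V) (e : E) : int :=
  \sum_(h : edge_end | (end_edge h == e) && end_at v h) pm (o.1 h).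

Definition nowhere_zero_flows (A : finZmodType) (o : arrows) :
    {set {ffun E -> A}} :=
  [set x : {ffun E -> A} |
    [forall v, \sum_e x e *~ incidence o v e == 0] && [forall e, x e != 0]].

(* The Tutte polynomial of the matroid on E with rank function r, evaluated
   at elements of an arbitrary commutative ring.  The exponents are the corank
   and the nullity of T; for a matroid no subtraction is truncated. *)
Definition tutte (r : {set E} -> nat) (R : comNzRingType) (x y : R) : R :=
  \sum_(T : {set E}) (x - 1) ^+ (r [set: E] - r T) * (y - 1) ^+ (#|T| - r T).

(* The defining property of the modular flow polynomial; odd orders being
   infinite in number, at most one polynomial has it. *)
Definition counts_modular_flows (p : {poly int}) : Prop :=
  forall (o : arrows), is_orientation o ->
  forall (A : finZmodType), odd #|A| ->
    p.[#|A|%:R] = #|nowhere_zero_flows A o|%:R.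

Definition modular_flow_poly : {poly int} :=
  (-1) ^ cyclomatic *: tutte bias_rank 0 (1 - 'X : {poly int}).

End SignedGraph.

(* Main.v *)
Require Import Defs.
From mathcomp Require Import all_boot all_order all_algebra.
From mathcomp Require Import boolp.
From mathcomp Require Import zify ring lra.
Set Implicit Arguments.
Unset Strict Implicit.
Unset Printing Implicit Defensive.
Import Order.TTheory GRing.Theory Num.Theory.
Local Open Scope ring_scope.

(** Write r for the rank function of the bias matroid, and H for the incidence
    matrix of some orientation.

    The two halves of the statement rest on one fact: for every set T of edges,
    the columns of H in T have rank r(T), over the rationals as well as, in the
    appropriate sense, over any abelian group without 2-torsion.  Indeed a
    vector y in the left kernel satisfies y(u) = sigma(e) y(v) on each edge e
    with ends u and v, and y(u) = 0 on each halfedge at u.  Hence y vanishes on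
    the unbalanced components of T and is a multiple of a +-1 potential on each
    balanced one.  This is [kernel_potential], stated modulo a subgroup so that
    it describes the cokernel too.  It uses Harary's theorem that T is balanced
    exactly if it has a potential, [balanced_potential], whose hard direction is
    obtained by showing that a minimal edge set without potential is a negative
    circle.

    Counting flows.  By the above, the A-flows supported in T number
    |A|^(|T| - r(T)) when |A| is odd ([card_supported_flows]): the image of H is
    the kernel of an explicit projection.  Inclusion-exclusion over the edges
    where a flow vanishes then gives the Tutte polynomial
    ([nowhere_zero_modular_flows]).

    Counting orientations.  An orientation is totally cyclic exactly if it has
    a strictly positive rational flow ([totally_cyclicP]).  If there is such a
    flow, a nonnegative flow of minimal support through a given edge is carried
    by a circuit, and this circuit has neither source nor sink because the flow
    is conserved.  Conversely, in a circuit without source or sink one can walk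
    along the arrows for ever; a periodic part of the walk is a nonzero
    nonnegative flow, and its support is the whole circuit by minimality.

    After a reference orientation is fixed, the totally cyclic orientations
    are therefore the sign vectors of the nowhere-zero elements of the flow
    space W, that is, the regions of the arrangement cut out of W by the
    coordinate hyperplanes.  Zaslavsky's formula ([card_cells]), proved by
    deletion and restriction, counts them as the sum over B of
    (-1)^(|B| + dim W + dim W_B), where W_B, the space of flows vanishing on B,
    has dimension |T| - r(T) for T the complement of B.  Comparison with the
    polynomial at -1 is immediate. *)

(** * Ends of edges *)

Lemma pmN b : pm (~~ b) = - pm b.
Proof. by case: b. Qed.

Lemma pm_neg b c : b != c -> pm b = - pm c.
Proof. by case: b; case: c. Qed.

Lemma pm_mul b c : pm (b == c) = pm b * pm c.
Proof. by case: b; case: c. Qed.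

Lemma pm_sqr b : pm b * pm b = 1.
Proof. by case: b. Qed.

Section Ends.
Variables (V E : finType) (S : signed_graph V E).
Implicit Types (e : E) (v : V) (T C : {set E}).

Local Notation edge_end := (edge_end S).

Lemma end_node_subproof (h : edge_end) : exists v, end_at v h.
Proof.
case: h => [[e i]] /= He; rewrite /end_at /=.
by case: (endpoint S e i) He => [v _|//]; exists v.
Qed.

(** The node at which an end is attached. *)
Definition end_node (h : edge_end) : V := xchoose (end_node_subproof h).

Lemma end_atE v (h : edge_end) : end_at v h = (end_node h == v).
Proof.
have := xchooseP (end_node_subproof h); rewrite -/(end_node h) /end_at.
by move/eqP=> ->; apply/eqP/eqP=> [[]|->].
Qed.

(** The ends of an edge, according to its kind. *)
Variant edge_spec e : edge_kind V -> Type :=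
| TwoEndedSpec u v g (h0 h1 : edge_end) of S e = TwoEnded u v g
    & h0 != h1 & end_node h0 = u & end_node h1 = v
    & (forall h, (end_edge h == e) = (h == h0) || (h == h1))
    : edge_spec e (TwoEnded u v g)
| HalfedgeSpec u (h0 : edge_end) of S e = Halfedge u
    & end_node h0 = u
    & (forall h, (end_edge h == e) = (h == h0))
    : edge_spec e (Halfedge u)
| LooseSpec of S e = LooseEdge & (forall h : edge_end, (end_edge h == e) = false)
    : edge_spec e LooseEdge.

Lemma edgeP e : edge_spec e (S e).
Proof.
case Se: (S e) => [u v g|u|].
- have H0 : endpoint S e false != None by rewrite /endpoint Se.
  have H1 : endpoint S e true != None by rewrite /endpoint Se.
  pose h0 : edge_end := exist _ (e, false) H0.
  pose h1 : edge_end := exist _ (e, true) H1.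
  apply: (@TwoEndedSpec _ _ _ _ h0 h1) => //.
  + by rewrite -val_eqE /= xpair_eqE andbF.
  + by apply/eqP; rewrite -end_atE /end_at /= /endpoint Se.
  + by apply/eqP; rewrite -end_atE /end_at /= /endpoint Se.
  + case=> [[f i] Hi]; rewrite /end_edge /h0 /h1 -!val_eqE /= !xpair_eqE.
    by case: i Hi => Hi; rewrite ?andbF ?orbF ?andbT.
- have H0 : endpoint S e false != None by rewrite /endpoint Se.
  pose h0 : edge_end := exist _ (e, false) H0.
  apply: (@HalfedgeSpec _ _ h0) => //.
  + by apply/eqP; rewrite -end_atE /end_at /= /endpoint Se.
  + case=> [[f i] Hi]; rewrite /end_edge /h0 -!val_eqE /= !xpair_eqE.
    case: i Hi => Hi; rewrite ?andbT // andbF; apply/eqP=> ef.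
    by move: Hi; rewrite /endpoint ef Se.
- constructor=> //; case=> [[f i] Hi]; rewrite /end_edge /=; apply/eqP=> ef.
  by move: Hi; rewrite /endpoint ef Se.
Qed.

Lemma big_two_ends (R : Type) (idx : R) (op : Monoid.com_law idx) e
    (h0 h1 : edge_end) (F : edge_end -> R) :
  h0 != h1 -> (forall h, (end_edge h == e) = (h == h0) || (h == h1)) ->
  \big[op/idx]_(h : edge_end | end_edge h == e) F h = op (F h0) (F h1).
Proof.
move=> ne He; rewrite (bigD1 h0) ?He ?eqxx //= (bigD1 h1) /=; last first.
  by rewrite He eqxx orbT eq_sym.
rewrite big1 ?Monoid.mulm1 // => h; rewrite He.
by case: (h == h0) => //=; case: (h == h1).
Qed.

Lemma big_one_end (R : Type) (idx : R) (op : Monoid.com_law idx) e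
    (h0 : edge_end) (F : edge_end -> R) :
  (forall h, (end_edge h == e) = (h == h0)) ->
  \big[op/idx]_(h : edge_end | end_edge h == e) F h = F h0.
Proof. by move=> He; rewrite (eq_bigl (pred1 h0)) ?big_pred1_eq. Qed.

Lemma big_no_end (R : Type) (idx : R) (op : Monoid.com_law idx) e
    (F : edge_end -> R) :
  (forall h : edge_end, (end_edge h == e) = false) ->
  \big[op/idx]_(h : edge_end | end_edge h == e) F h = idx.
Proof. by move=> He; apply: big_pred0. Qed.

Lemma degreeE T v :
  degree S T v = (\sum_(h : edge_end | end_edge h \in T) (end_node h == v))%N.
Proof.
rewrite /degree -sum1dep_card big_mkcondr /=.
by apply: eq_bigr => h _; rewrite end_atE; case: eqP.
Qed.

Lemma big_by_edge (R : Type) (idx : R) (op : Monoid.com_law idx) T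
    (F : edge_end -> R) :
  \big[op/idx]_(h : edge_end | end_edge h \in T) F h =
  \big[op/idx]_(e in T) \big[op/idx]_(h : edge_end | end_edge h == e) F h.
Proof.
rewrite (partition_big (@end_edge _ _ S) (mem T)) //=.
by apply: eq_bigr => e eT; apply: eq_bigl => h; case: eqP => [->|]; rewrite ?eT ?andbF.
Qed.

Lemma degree_gt0P T v :
  reflect (exists2 h : edge_end, end_edge h \in T & end_node h = v)
          (0 < degree S T v)%N.
Proof.
rewrite /degree; apply: (iffP card_gt0P) => [[h]|[h hT hv]].
  by rewrite inE end_atE => /andP[hT /eqP]; exists h.
by exists h; rewrite inE end_atE hT hv eqxx.
Qed.

Lemma sum_degree T : (forall e, e \in T -> is_two_ended S e) ->
  (\sum_v degree S T v = 2 * #|T|)%N.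
Proof.
move=> T2; rewrite (eq_bigr _ (fun v _ => degreeE T v)) exchange_big /=.
rewrite (eq_bigr (fun=> 1%N)) => [|h _]; last first.
  by rewrite (bigD1 (end_node h)) //= eqxx big1 // => v; rewrite eq_sym => /negPf->.
rewrite big_by_edge (eq_bigr (fun=> 2%N)) => [|e /T2].
  by rewrite big_const iter_addn_0.
rewrite /is_two_ended; case: edgeP => //= u v g h0 h1 _ ne _ _ He _.
by rewrite (big_two_ends _ _ ne He).
Qed.

Lemma adjP T u v :
  reflect (exists2 e, e \in T &
             exists g, S e = TwoEnded u v g \/ S e = TwoEnded v u g)
          (adj S T u v).
Proof.
apply: (iffP exists_inP) => [[e eT /existsP[i Hi]]|[e eT [g Hg]]];
    exists e => //.
  move: Hi; rewrite /endpoint; case: (S e) => [a b g|a|]; case: i => //=;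
    rewrite ?andbF //; case/andP=> /eqP[<-] /eqP[<-]; exists g; by [left|right].
by case: Hg => Se; apply/existsP; [exists false|exists true];
  rewrite /endpoint Se /= !eqxx.
Qed.

Lemma adj_two_ended T e u v g :
  e \in T -> S e = TwoEnded u v g -> adj S T u v.
Proof. by move=> eT Se; apply/adjP; exists e => //; exists g; left. Qed.

Lemma connect_adj_sym T : connect_sym (adj S T).
Proof.
by apply: sym_connect_sym => u v; apply/adjP/adjP => -[e eT [g [] Se]];
  exists e => //; exists g; [right|left|right|left].
Qed.

Lemma connect_ends T (h h' : edge_end) : end_edge h \in T ->
  end_edge h' = end_edge h -> connect (adj S T) (end_node h) (end_node h').
Proof.
move: {2}(end_edge h) (erefl (end_edge h)) => e he; rewrite he => eT h'e.
move/eqP: he; move/eqP: h'e.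
case: (edgeP e) => [u v g h0 h1 Se _ hu hv He|u h0 _ _ He|_ He]; rewrite !He //.
  have uv : connect (adj S T) (end_node h0) (end_node h1).
    rewrite hu hv; apply: connect1; exact: adj_two_ended Se.
  by do 2![case/orP=> /eqP->]; rewrite ?connect0 // connect_adj_sym.
by move/eqP->; move/eqP->.
Qed.

End Ends.

(** * Balance and potentials *)

Section Potentials.
Variables (V E : finType) (S : signed_graph V E).
Implicit Types (e : E) (v : V) (T C : {set E}) (s t : V -> bool).

(** The edge e is consistent with s : V -> bool, read as a two-colouring of the
    nodes, when it is loose or has two ends, of the same colour exactly if e is
    positive. *)
Definition consistent s e : bool :=
  match S e with
  | TwoEnded u v g => (s u == s v) == g
  | Halfedge _ => false
  | LooseEdge => true
  end.

(** A potential of T is a colouring with which all edges of T are consistent. *)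
Definition has_potential T : bool :=
  [exists s : {ffun V -> bool}, [forall e in T, consistent s e]].

Lemma eq_consistent s t : s =1 t -> consistent s =1 consistent t.
Proof. by move=> st e; rewrite /consistent; case: (S e) => // u v g; rewrite !st. Qed.

Lemma has_potentialP T :
  reflect (exists s, forall e, e \in T -> consistent s e) (has_potential T).
Proof.
apply: (iffP existsP) => [[s /forall_inP Hs]|[s Hs]]; first by exists s.
exists [ffun v => s v]; apply/forall_inP => e eT.
by rewrite (@eq_consistent _ s) ?Hs // => v; rewrite ffunE.
Qed.

(** Every node of a circle has even degree, so that the colours of the ends
    cancel and the sign only depends on the inconsistent edges. *)
Lemma circle_sign_consistent s C : circle S C ->
  circle_sign S C = \prod_(e in C) pm (consistent s e).
Proof.
case/and4P=> _ /forall_inP C2 /forallP Cdeg _.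
have -> : circle_sign S C = \prod_(e in C) (pm (consistent s e) *
    \prod_(h : edge_end S | end_edge h == e) pm (s (end_node h))).
  apply: eq_bigr => e /C2; rewrite /is_two_ended /edge_sign /consistent.
  case: edgeP => // u v g h0 h1 _ ne <- <- He _.
  rewrite (big_two_ends _ _ ne He) /=.
  by case: (s _); case: (s _); case: g.
rewrite big_split /= -[RHS]mulr1; congr (_ * _).
rewrite -(big_by_edge _ _ (fun h => pm (s (end_node h)))).
rewrite (partition_big (@end_node _ _ S) xpredT) //= big1 // => v _.
rewrite (eq_bigr (fun=> pm (s v))) => [|h /andP[_ /eqP-> //]].
rewrite prodr_const.
have -> : #|[pred h : edge_end S | (end_edge h \in C) && (end_node h == v)]|
   = degree S C v.
  rewrite /degree cardsE; apply: eq_card => h.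
  by rewrite unfold_in /= [RHS]unfold_in end_atE.
have := Cdeg v; case: (degree S C v) => //= d /eqP->.
by rewrite expr2 pm_sqr.
Qed.

(** The edges with two ends whose ends are separated by t. *)
Definition cuts t e : bool :=
  if S e is TwoEnded u v _ then t u != t v else false.

(** A minimal edge set C without potential, and without halfedges, is a negative
    circle.  The cuts of C, that is the sets of edges of C separated by some t,
    carry the proof: adding t to a colouring flips the consistency of exactly the
    edges that t separates. *)
Section MinimalInconsistent.
Variable C : {set E}.
Hypothesis Cmin : minset (fun T => ~~ has_potential T) C.
Hypothesis Chalf : forall e, e \in C -> ~~ is_halfedge S e.

Lemma minimal_rem f : f \in C -> has_potential (C :\ f).
Proof.
move=> fC; apply: contraT => HC.
have /setP/(_ f) := minsetinf Cmin HC (subD1set _ _).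
by rewrite !inE eqxx fC.
Qed.

Lemma minimal_two_ended e : e \in C -> is_two_ended S e.
Proof.
move=> eC; have := Chalf eC; rewrite /is_halfedge /is_two_ended.
case Se: (S e) => // _; case/minsetP: Cmin => /negP[]; have /has_potentialP[s Hs] := minimal_rem eC.
apply/has_potentialP; exists s => f fC; have [->|fe] := eqVneq f e.
  by rewrite /consistent Se.
by apply: Hs; rewrite !inE fe.
Qed.

(** Removing an edge f from C leaves a potential, inconsistent with f only. *)
Lemma minimal_flip f : f \in C ->
  exists s, forall e, e \in C -> consistent s e = (e != f).
Proof.
move=> fC; have /has_potentialP[s Hs] := minimal_rem fC.
exists s => e eC; have [->|ef] := eqVneq e f; last by rewrite Hs // !inE ef.
apply/negP=> sf; case/minsetP: Cmin => /negP[]; apply/has_potentialP.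
exists s => a aC; have [->//|af] := eqVneq a f.
by apply: Hs; rewrite !inE af.
Qed.

(** A cut with a single edge f would turn the colouring inconsistent with f only
    into a potential of C. *)
Lemma minimal_no_bridge t f : f \in C ->
  (forall e, e \in C -> cuts t e = (e == f)) -> False.
Proof.
move=> fC tf; have [s sf] := minimal_flip fC.
case/minsetP: Cmin => /negP[]; apply/has_potentialP.
exists (fun v => s v (+) t v) => e eC.
have := tf e eC; have := sf e eC; have := minimal_two_ended eC.
rewrite /consistent /cuts /is_two_ended; case: (S e) => // u v g _.
case: (e == f) => /=; case: (s u); case: (s v); case: (t u); case: (t v);
  by case: g.
Qed.

(** Any two edges of C form a cut. *)
Lemma minimal_cut2 f g : f \in C -> g \in C -> f != g ->
  exists t, forall e, e \in C -> cuts t e = (e == f) || (e == g).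
Proof.
move=> fC gC fg; have [s1 H1] := minimal_flip fC; have [s2 H2] := minimal_flip gC.
exists (fun v => s1 v (+) s2 v) => e eC.
have := H1 e eC; have := H2 e eC; have := minimal_two_ended eC.
rewrite /consistent /cuts /is_two_ended; case: (S e) => // u v b _.
have [->|ef] := eqVneq e f; [rewrite fg|]; last case: (e == g);
  by case: (s1 u); case: (s1 v); case: (s2 u); case: (s2 v); case: b.
Qed.

Lemma minimal_degree_neq1 v : degree S C v != 1%N.
Proof.
apply/negP; rewrite degreeE => /eqP d1.
have /degree_gt0P[h hC hv] : (0 < degree S C v)%N by rewrite degreeE d1.
apply: (@minimal_no_bridge (fun w => w == v) (end_edge h)) => // e eC.
have sep (h' : edge_end S) : end_edge h' \in C -> end_node h' = v -> h' = h.
  move=> h'C h'v; apply/eqP; apply: contraT => ne; move: d1.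
  by rewrite (bigD1 h) //= (bigD1 h') /= ?h'C // hv h'v eqxx.
have := minimal_two_ended eC; rewrite /cuts /is_two_ended.
case: edgeP => // a b g h0 h1 _ ne ha hb He _.
have e0 : end_edge h0 = e by apply/eqP; rewrite He eqxx.
have e1 : end_edge h1 = e by apply/eqP; rewrite He eqxx orbT.
rewrite [RHS]eq_sym He -ha -hb.
have atv h' : end_edge h' = e -> (end_node h' == v) = (h == h').
  move=> eh'; apply/eqP/eqP => [/sep->|<-] //; by rewrite eh'.
rewrite !atv //; have [->|_] := eqVneq h h0; first by rewrite (negPf ne).
by case: (h == h1).
Qed.

(** With e0 a fixed edge of C, each other edge e is cut off together with e0
    by some t.  Sending e to its end on the side of a fixed end of e0 is
    injective and avoids the other end of e0. *)
Lemma minimal_card : (#|C| <= #|[set v | 0 < degree S C v]|)%N.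
Proof.
have [->|[e0 e0C]] := set_0Vmem C; first by rewrite cards0.
have := minimal_two_ended e0C; rewrite /is_two_ended.
case Se0: (S e0) => [a b g||] // _.
have /fin_all_exists[t Ht] : forall e, exists t, e \in C :\ e0 ->
    [/\ t a, ~~ t b & forall f, f \in C -> cuts t f = (f == e0) || (f == e)].
  move=> e; have [|eC] := boolP (e \in C :\ e0); last by exists xpred0.
  rewrite !inE => /andP[ne eC]; rewrite eq_sym in ne.
  have [t Ht] := minimal_cut2 e0C eC ne.
  have := Ht e0 e0C; rewrite eqxx /cuts Se0 /= => tab.
  case ta: (t a) tab => tb.
    by exists t => _; rewrite ta; split => //; case: (t b) tb.
  exists (fun v => ~~ t v) => _; split; rewrite /= ?ta //.
  move=> f fC; rewrite -Ht // /cuts; case: (S f) => // u v _.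
  by case: (t u); case: (t v).
have /fin_all_exists[w Hw] : forall e, exists w, e \in C :\ e0 ->
    [/\ t e w, (0 < degree S C w)%N &
        exists z, ~~ t e z /\ (S e = TwoEnded w z (edge_sign S e == 1)
                             \/ S e = TwoEnded z w (edge_sign S e == 1))].
  move=> e; have [eCe|eC] := boolP (e \in C :\ e0); last by exists a.
  have [_ _ /(_ e)] := Ht e eCe; have := eCe; rewrite !inE => /andP[ne eC].
  rewrite eC eqxx orbT /cuts /edge_sign => /(_ isT).
  case: edgeP => // u v i h0 h1 _ _ hu hv He tuv.
  have Cu : (0 < degree S C u)%N.
    apply/degree_gt0P; exists h0 => //; have := He h0.
    by rewrite eqxx => /eqP->.
  have Cv : (0 < degree S C v)%N.
    apply/degree_gt0P; exists h1 => //; have := He h1.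
    by rewrite eqxx orbT => /eqP->.
  have i1 : (pm i == 1) = i by case: i.
  case tu: (t e u) tuv => tv.
    exists u => _; split=> //; exists v; rewrite i1; split; last by left.
    by case: (t e v) tv.
  exists v => _; split=> //; first by case: (t e v) tv.
  by exists u; rewrite i1 tu; split; last by right.
rewrite (cardsD1 e0) e0C.
have Cb : b \in [set v | 0 < degree S C v]%N.
  rewrite inE; apply/degree_gt0P; move: Se0; case: edgeP => //.
  move=> u v i h0 h1 _ _ hu hv He [_ <- _]; exists h1 => //.
  by have := He h1; rewrite eqxx orbT => /eqP->.
rewrite (cardsD1 b [set v | _]) Cb leq_add2l.
have w_inj : {in C :\ e0 &, injective w}.
  move=> e f eC fC wef; apply/eqP; apply: contraT => ef.
  have [tea teb te] := Ht e eC; have [tfa tfb tf] := Ht f fC.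
  have [tew _ [ze [tez Sez]]] := Hw e eC; have [tfw _ [zf [tfz Sfz]]] := Hw f fC.
  have [e0e eCC] := setD1P eC; have [e0f fCC] := setD1P fC.
  have tfwe : t f ze = t e ze || t f (w e).
    have := tf e eCC; rewrite (negPf ef) (negPf e0e) /cuts; case: Sez => ->;
    by rewrite (negPf tez) wef tfw; case: (t f ze).
  have tewf : t e zf = t e (w f).
    have := te f fCC; rewrite eq_sym in ef; rewrite (negPf ef) (negPf e0f) /cuts.
    case: Sfz => ->; by rewrite -wef tew; case: (t e zf).
  (* The nodes in t e but not in t f would be cut off by f only. *)
  exfalso; apply: (@minimal_no_bridge (fun v => t e v && ~~ t f v) f) => // c cC.
  have [->|cf] := eqVneq c f.
    rewrite /cuts; case: Sfz => ->;
    by rewrite tewf tfw (negPf tfz) -wef tew.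
  have [->|ce] := eqVneq c e.
    rewrite /cuts; case: Sez => ->; by rewrite wef tfw (negPf tez) !andbF.
  have [->|ce0] := eqVneq c e0.
    by rewrite /cuts Se0 tfa (negPf teb) andbF.
  have := te c cC; have := tf c cC; rewrite (negPf cf) (negPf ce) (negPf ce0).
  rewrite /cuts; case: (S c) => // u v _.
  by case: (t e u); case: (t e v); case: (t f u); case: (t f v).
rewrite -(card_in_imset w_inj); apply: subset_leq_card.
apply/subsetP => _ /imsetP[e eC ->]; have [tew Cw _] := Hw e eC.
rewrite !inE Cw andbT; apply: contraTneq tew => ->.
by have [_ + _] := Ht e eC.
Qed.

(** The degrees are at least 2 and, by [minimal_card], at most 2 on average. *)
Lemma minimal_degree2 v : (0 < degree S C v)%N -> degree S C v = 2%N.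
Proof.
set X := [set v | 0 < degree S C v]%N => Cv.
have le2 w : w \in X -> (2 <= degree S C w ?= iff (2 == degree S C w))%N.
  rewrite inE => Cw; split=> //.
  by move: Cw (minimal_degree_neq1 w); case: (degree _ _ _) => [|[]].
have [] := leqif_sum le2; rewrite sum_nat_const.
have -> : (\sum_(w in X) degree S C w = 2 * #|C|)%N.
  rewrite -(sum_degree minimal_two_ended) big_mkcond; apply: eq_bigr => w _.
  by rewrite inE; case: (degree _ _ _).
move=> le; rewrite eqn_leq le (mulnC 2) leq_mul2r minimal_card.
by move=> /esym/forall_inP/(_ v); rewrite inE => /(_ Cv)/eqP.
Qed.

Lemma minimal_connected u v : (0 < degree S C u)%N -> (0 < degree S C v)%N ->
  connect (adj S C) u v.
Proof.
move=> /degree_gt0P[h1 C1 hu] /degree_gt0P[h2 C2 hv]; apply: contraT => nuv.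
pose t w := connect (adj S C) u w.
have tE e (h h' : edge_end S) : e \in C -> end_edge h = e -> end_edge h' = e ->
    t (end_node h) = t (end_node h').
  move=> eC he h'e; apply: (same_connect_r (@connect_adj_sym _ _ S C)).
  by apply: connect_ends; rewrite ?he ?h'e.
have t1 : t (end_node h1) by rewrite hu /t connect0.
have t2 : ~~ t (end_node h2) by rewrite hv.
have ne : end_edge h1 != end_edge h2.
  by apply: contraNneq t2 => e12; rewrite -(tE _ h1 h2 C1 erefl (esym e12)).
have [s Hs] := minimal_cut2 C1 C2 ne.
(* No edge of C is separated by t, so the part of s inside t separates only the
   edge of h1. *)
exfalso; apply: (@minimal_no_bridge (fun w => s w && t w) _ C1) => e eC.
have := Hs e eC; have := minimal_two_ended eC; rewrite /cuts /is_two_ended.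
have te (h h' : edge_end S) := @tE e h h' eC.
case: edgeP te => // a b g k0 k1 _ _ <- <- He te _.
have k0e : end_edge k0 = e by apply/eqP; rewrite He eqxx.
have k1e : end_edge k1 = e by apply/eqP; rewrite He eqxx orbT.
rewrite -(te _ _ k0e k1e).
have [e1|_] := eqVneq e (end_edge h1).
  by rewrite (te _ h1) // t1 !andbT.
have [e2|_] := eqVneq e (end_edge h2).
  by rewrite (te _ h2) // (negPf t2) !andbF.
by case: (s _); case: (s _); case: (t _).
Qed.

Lemma minimal_circle : circle S C.
Proof.
apply/and4P; split.
- apply: contraTneq (minsetp Cmin) => ->; rewrite negbK; apply/has_potentialP.
  by exists xpredT => e; rewrite inE.
- by apply/forall_inP => e; apply: minimal_two_ended.
- by apply/forallP => v; apply/implyP => /minimal_degree2->.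
- apply/forallP => u; apply/forallP => v; apply/implyP => /andP[].
  exact: minimal_connected.
Qed.

Lemma minimal_negative : circle_sign S C = -1.
Proof.
have [e0 e0C] : exists e, e \in C.
  by case/and4P: minimal_circle => /set0Pn.
have [s Hs] := minimal_flip e0C.
rewrite (circle_sign_consistent s minimal_circle) (bigD1 e0) //= Hs // eqxx /=.
by rewrite big1 ?mulr1 // => e /andP[eC ne]; rewrite Hs // ne.
Qed.

End MinimalInconsistent.

(** Harary's criterion for balance. *)
Lemma balanced_potential T : balanced S T = has_potential T.
Proof.
apply/andP/idP => [[/forall_inP Thalf /forallP Tpos]|/has_potentialP[s Hs]].
  apply: contraT => nT.
  have [C Cmin CT] := minset_exists (P := fun T => ~~ has_potential T) nT.
  have Chalf e : e \in C -> ~~ is_halfedge S e by move/(subsetP CT)/Thalf.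
  have := Tpos C; rewrite CT (minimal_circle Cmin Chalf) /=.
  by rewrite (minimal_negative Cmin Chalf).
split; first by apply/forall_inP => e /Hs; rewrite /consistent /is_halfedge; case: (S e).
apply/forallP => C; apply/implyP => /andP[/subsetP CT Cc].
by rewrite (circle_sign_consistent s Cc) big1 // => e /CT/Hs->.
Qed.

End Potentials.

(** * Balanced components and the left kernel of the incidence matrix *)

Lemma mulrz_pm (B : zmodType) (x : B) b : x *~ pm b = if b then x else - x.
Proof. by case: b; rewrite ?mulrN1z ?mulr1z. Qed.

Section Components.
Variables (V E : finType) (S : signed_graph V E).
Implicit Types (e : E) (v : V) (T C : {set E}).

Local Notation root T := (fingraph.root (adj S T)).

(** The component of T that contains v is balanced. *)
Definition balanced_at T v : bool :=
  balanced S (component_edges S T [set w | connect (adj S T) v w]).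

(** One node in each balanced component of T. *)
Definition balanced_roots T : {set V} :=
  [set v | (v \in roots (adj S T)) && balanced_at T v].

Lemma component_edgesP T (K : {set V}) e :
  reflect (e \in T /\ exists2 h : edge_end S, end_edge h = e & end_node h \in K)
          (e \in component_edges S T K).
Proof.
rewrite inE; apply: (iffP andP) => -[eT].
  case/existsP=> i /exists_inP[v vK ev]; split=> //.
  have Hi : endpoint S e i != None by rewrite (eqP ev).
  exists (exist _ (e, i) Hi) => //; rewrite (_ : end_node _ = v) //.
  by apply/eqP; rewrite -end_atE /end_at.
case=> h he hK; split=> //; apply/existsP; exists (val h).2; apply/exists_inP.
by exists (end_node h) => //; have := end_atE (end_node h) h; rewrite /end_at -he eqxx.
Qed.

Lemma balanced_at_connect T u v :
  connect (adj S T) u v -> balanced_at T u = balanced_at T v.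
Proof.
move=> uv; rewrite /balanced_at; congr (balanced S (component_edges S T _)).
by apply/setP=> w; rewrite !inE (same_connect (@connect_adj_sym _ _ S T) uv).
Qed.

Lemma balanced_at_root T v : balanced_at T (root T v) = balanced_at T v.
Proof. by rewrite -(balanced_at_connect (connect_root _ v)). Qed.

Lemma root_balanced_roots T v : (root T v \in balanced_roots T) = balanced_at T v.
Proof. by rewrite inE [_ \in roots _](roots_root (@connect_adj_sym _ _ S T)) balanced_at_root. Qed.

Lemma balanced_roots_id T v : v \in balanced_roots T -> root T v = v.
Proof. by rewrite inE => /andP[/eqP]. Qed.

Lemma nb_balancedE T : nb_balanced S T = #|balanced_roots T|.
Proof.
pose block v := [set w in [set: V] | connect (adj S T) v w].
have blockE v : block v = [set w | connect (adj S T) v w].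
  by apply/setP=> w; rewrite !inE.
have csym := @connect_adj_sym _ _ S T.
rewrite /nb_balanced -(@card_in_imset _ _ block (balanced_roots T)).
  apply: eq_card => K; rewrite inE; apply/andP/imsetP => [[]|[v vR ->]].
    case/imsetP=> v _ -> /= Kb; exists (root T v).
      by rewrite root_balanced_roots /balanced_at -blockE.
    by apply/setP=> w; rewrite !inE /= (same_connect csym (connect_root _ v)).
  split; first by apply/imsetP; exists v; rewrite ?inE.
  by move: vR; rewrite inE blockE => /andP[].
move=> u v uR vR /setP/(_ v); rewrite !inE connect0 -(root_connect csym).
by rewrite (balanced_roots_id uR) (balanced_roots_id vR) => /eqP.
Qed.

(** The potentials of the balanced components, put together and normalized at
    the roots. *)
Lemma exists_component_potential T : exists s : V -> bool,
  (forall r, r \in balanced_roots T -> s r) /\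
  (forall h : edge_end S, end_edge h \in T -> balanced_at T (end_node h) ->
     consistent S s (end_edge h)).
Proof.
have csym := @connect_adj_sym _ _ S T.
have /fin_all_exists[p Hp] : forall r, exists p : V -> bool,
    balanced_at T r -> forall e,
    e \in component_edges S T [set w | connect (adj S T) r w] -> consistent S p e.
  move=> r; have [|_] := boolP (balanced_at T r).
    rewrite /balanced_at balanced_potential.
    by case/has_potentialP=> p Hp; exists p.
  by exists xpredT.
pose s v := p (root T v) v == p (root T v) (root T v).
exists s; split=> [r rR|h hT hb]; first by rewrite /s (balanced_roots_id rR) eqxx.
set e := end_edge h in hT *; set r := root T (end_node h).
have pe : consistent S (p r) e.
  apply: Hp; first by rewrite balanced_at_root.
  apply/component_edgesP; split=> //; exists h => //.
  by rewrite inE csym connect_root.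
have rootE (h' : edge_end S) : end_edge h' = e -> root T (end_node h') = r.
  move=> h'e; apply/eqP; rewrite root_connect // csym.
  exact: connect_ends.
move: pe; rewrite /consistent; case: edgeP => // a b g h0 h1 _ _ <- <- He.
have h0e : end_edge h0 = e by apply/eqP; rewrite He eqxx.
have h1e : end_edge h1 = e by apply/eqP; rewrite He eqxx orbT.
rewrite /s !rootE //.
by case: (p r _); case: (p r _); case: (p r _).
Qed.

Variable o : arrows S.
Hypothesis o_or : is_orientation o.

(** The arrows of the two ends agree exactly if the edge is negative. *)
Lemma orientation_sign e u v g (h0 h1 : edge_end S) :
    S e = TwoEnded u v g -> h0 != h1 -> end_edge h0 = e -> end_edge h1 = e ->
  o.1 h1 = o.1 h0 (+) g.
Proof.
move=> Se ne e0 e1; have /forallP/(_ h0)/forallP/(_ h1)/implyP := o_or.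
rewrite ne e0 e1 eqxx /edge_sign Se => /(_ isT).
by case: (o.1 h0); case: (o.1 h1); case: g {Se}.
Qed.

Lemma sum_incidence (B : zmodType) (y : V -> B) e :
  \sum_v y v *~ incidence o v e =
  \sum_(h : edge_end S | end_edge h == e) y (end_node h) *~ pm (o.1 h).
Proof.
rewrite [RHS](partition_big (@end_node _ _ S) xpredT) //=.
apply: eq_bigr => v _; rewrite /incidence mulrz_sumr.
rewrite (eq_bigl (fun h => (end_edge h == e) && (end_node h == v))).
  by apply: eq_bigr => h /andP[_ /eqP->].
by move=> h; rewrite end_atE.
Qed.

(** The pairing of y with the column of e, up to a global sign pm b. *)
Variant incidence_spec (B : zmodType) (y : V -> B) e : edge_kind V -> B -> Type :=
| IncidenceTwo u v g b (h0 h1 : edge_end S)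
    of S e = TwoEnded u v g & end_edge h0 = e & end_edge h1 = e
    & end_node h0 = u & end_node h1 = v
    : incidence_spec y e (TwoEnded u v g) ((y u - y v *~ pm g) *~ pm b)
| IncidenceHalf u b (h0 : edge_end S) of S e = Halfedge u & end_edge h0 = e & end_node h0 = u
    : incidence_spec y e (Halfedge u) (y u *~ pm b)
| IncidenceLoose of S e = LooseEdge : incidence_spec y e LooseEdge 0.

Lemma incidenceP (B : zmodType) (y : V -> B) e :
  incidence_spec y e (S e) (\sum_v y v *~ incidence o v e).
Proof.
rewrite sum_incidence; case: edgeP => [u v g h0 h1 Se ne hu hv He|u h0 Se hu He|Se He].
- have e0 : end_edge h0 = e by apply/eqP; rewrite He eqxx.
  have e1 : end_edge h1 = e by apply/eqP; rewrite He eqxx orbT.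
  rewrite (big_two_ends _ _ ne He) (orientation_sign Se ne e0 e1) /=.
  have -> : y (end_node h0) *~ pm (o.1 h0) + y (end_node h1) *~ pm (o.1 h0 (+) g)
     = (y u - y v *~ pm g) *~ pm (o.1 h0).
    rewrite hu hv !mulrz_pm; case: (o.1 h0); case: g {Se}; rewrite //= ?opprB ?opprK //;
      exact: addrC.
  by apply: IncidenceTwo hu hv.
- rewrite (big_one_end _ _ He) hu; apply: IncidenceHalf hu => //.
  by apply/eqP; rewrite He.
- by rewrite big_no_end //; constructor.
Qed.


Variables (T : {set E}) (s : V -> bool).
Hypothesis s_root : forall r, r \in balanced_roots T -> s r.
Hypothesis s_pot : forall h : edge_end S, end_edge h \in T ->
  balanced_at T (end_node h) -> consistent S s (end_edge h).

(** Any choice c of values at the roots of the balanced components extends, along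
    the potential s, to an element of the left kernel. *)
Lemma potential_in_kernel (B : zmodType) (c : V -> B) e : e \in T ->
  \sum_v (if balanced_at T v then c (root T v) *~ pm (s v) else 0)
           *~ incidence o v e = 0.
Proof.
pose y v := if balanced_at T v then c (root T v) *~ pm (s v) else 0; move=> eT.
rewrite -[LHS]/(\sum_v y v *~ incidence o v e).
case: incidenceP => [u v g b h0 h1 Se e0 e1 h0u h1v|u b h0 Se e0 h0u|_ //].
  have uv : connect (adj S T) u v by apply: connect1; apply: adj_two_ended Se.
  rewrite /y -(balanced_at_connect uv).
  case ub: (balanced_at T u); last by rewrite mul0rz subr0 mul0rz.
  have := s_pot (h := h0); rewrite e0 h0u => /(_ eT ub).
  rewrite /consistent Se => /eqP <-; rewrite pm_mul.
  have /eqP-> : root T v == root T u.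
    by rewrite root_connect 1?connect_adj_sym //; apply: connect_adj_sym.
  rewrite -[_ *~ pm (s v) *~ _]mulrzA mulrCA pm_sqr mulr1.
  by rewrite subrr mul0rz.
rewrite /y; case ub: (balanced_at T u); last by rewrite mul0rz.
have := s_pot (h := h0); rewrite e0 h0u => /(_ eT ub).
by rewrite /consistent Se.
Qed.

(** Elements of the left kernel are determined by their values at the roots of
    the balanced components.  It is stated modulo a subgroup I whose
    quotient has no 2-torsion, so as to cover the cokernel as well. *)
Lemma kernel_potential (B : zmodType) (I : {pred B}) (y : V -> B) :
    zmod_closed I -> (forall x, x + x \in I -> x \in I) ->
    (forall e, e \in T -> \sum_v y v *~ incidence o v e \in I) ->
  forall v, y v - (if balanced_at T v then y (root T v) *~ pm (s v) else 0) \in I.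
Proof.
move=> [I0 IB] I2 Hy.
have IN x : x \in I -> - x \in I by move=> xI; rewrite -sub0r IB.
have INE x : (- x \in I) = (x \in I).
  by apply/idP/idP=> /IN //; rewrite opprK.
have ID x z : x \in I -> z \in I -> x + z \in I.
  by move=> xI zI; rewrite -[z]opprK IB // IN.
have Ipm x b : (x *~ pm b \in I) = (x \in I).
  by rewrite mulrz_pm; case: b.
have two e u v g : e \in T -> S e = TwoEnded u v g -> y u - y v *~ pm g \in I.
  move=> eT Se; have := Hy e eT.
  by case: incidenceP => [? ? ? ? ? ? + _ _ _ _|? ? ? + _ _|+]; rewrite ?Se;
    [case=> <- <- <-; rewrite Ipm| | ]. 
have half e u : e \in T -> S e = Halfedge u -> y u \in I.
  move=> eT Se; have := Hy e eT.
  by case: incidenceP => [? ? ? ? ? ? + _ _ _ _|? ? ? + _ _|+]; rewrite ?Se;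
    [ |case=> <-; rewrite Ipm| ].
have conn u v : connect (adj S T) u v -> (y v - y u \in I) || (y v + y u \in I).
  move=> /connectP[p]; elim/last_ind: p v => [|p w IHp] v /=.
    by move=> _ ->; rewrite subrr I0.
  rewrite rcons_path last_rcons => /andP[up /adjP[e eT [g Se]]] ->.
  have pw : y w - y (last u p) *~ pm g \in I.
    case: Se => /(two _ _ _ _ eT) //; rewrite !mulrz_pm.
    case: (g); first by rewrite -INE opprB.
    by rewrite !opprK addrC.
  case/orP: (IHp _ up erefl) => H; move: pw; rewrite mulrz_pm;
    case: g {Se} => pw; apply/orP.
  - by left; have := ID _ _ pw H; rewrite addrA subrK.
  - right; have := IB _ _ pw H; rewrite opprK.
    by rewrite opprB (addrC (y u)) addrA addrK.
  - by right; have := ID _ _ pw H; rewrite addrA subrK.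
  - left; have := IB _ _ pw H; rewrite opprK.
    by rewrite opprD addrA addrK.
move=> v; case bv: (balanced_at T v).
  pose r := root T v; have rv : connect (adj S T) r v.
    by rewrite connect_adj_sym connect_root.
  have : y v *~ pm (s v) - y r *~ pm (s r) \in I.
    case/connectP: rv => p; have := bv; rewrite -balanced_at_root -/r.
    move: r => r br; elim/last_ind: p v {bv} => [|p w IHp] v /=.
      by move=> _ ->; rewrite subrr I0.
    rewrite rcons_path last_rcons => /andP[rp /adjP[e eT [g Se]]] ->.
    have rl : connect (adj S T) r (last r p) by apply/connectP; exists p.
    have := IHp _ rp erefl; move: (last r p) Se rl => l Se rl H.
    have lw : connect (adj S T) l w by apply: connect1; apply/adjP; exists e => //; exists g.
    rewrite -(subrKA (y l *~ pm (s l))) ID //.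
    have cE : forall a b, S e = TwoEnded a b g -> connect (adj S T) r a ->
       y a *~ pm (s a) - y b *~ pm (s b) \in I.
      move=> a b Sab ra; have := edgeP S e; rewrite Sab => spec.
      inversion spec as [? ? ? h0 h1 _ _ ha hb He| |]; subst.
      have /eqP h0e : end_edge h0 == e by rewrite He eqxx.
      have := s_pot (h := h0); rewrite h0e -(balanced_at_connect ra) => /(_ eT br).
      rewrite /consistent Sab => /eqP gE; have := two _ _ _ _ eT Sab.
      by rewrite -(Ipm _ (s (end_node h0))) mulrzBl -mulrzA -gE pm_mul mulrAC pm_sqr mul1r.
    case: Se => Se; last by apply: cE => //; apply: connect_trans rl lw.
    by rewrite -INE opprB; apply: cE.
  rewrite (s_root (r := r)) ?root_balanced_roots // [_ *~ pm true]mulr1z => H.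
  rewrite -(Ipm _ (s v)) mulrzBl -mulrzA pm_sqr mulr1z.
  exact: H.
rewrite subr0; apply: contraFT bv => yv.
(* Modulo I, y w is y v or - y v for each w in the component of v, but not both;
   telling these cases apart gives a potential of the component. *)
rewrite /balanced_at balanced_potential; apply/has_potentialP.
have sep w : connect (adj S T) v w -> (y w - y v \in I) = ~~ (y w + y v \in I).
  move=> vw; have := conn v w vw; case ym: (y w - y v \in I) => /=; last by move->.
  move=> _; apply/esym; apply: contra yv => yp; apply: I2.
  by have := IB _ _ yp ym; rewrite opprB addrC addrA subrK.
exists (fun w => y w - y v \in I) => e /component_edgesP[eT [h he]].
rewrite inE /consistent => vh.
have cv (h' : edge_end S) : end_edge h' = e -> connect (adj S T) v (end_node h').
  by move=> h'e; apply: (connect_trans vh); apply: connect_ends; rewrite ?he.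
have eqI x z : x - z \in I -> (x \in I) = (z \in I).
  move=> xz; apply/idP/idP => [xI|/(ID _ _ xz)]; last by rewrite subrK.
  by have := IB _ _ xI xz; rewrite opprB addrC subrK.
have := two e; have := half e; case: edgeP => // [a b g h0 h1 Se _ ha hb He _|a h0 Se ha He].
  move=> /(_ a b g eT erefl); rewrite -ha -hb.
  have /cv c0 : end_edge h0 = e by apply/eqP; rewrite He eqxx.
  have /cv c1 : end_edge h1 = e by apply/eqP; rewrite He eqxx orbT.
  rewrite (sep _ c1); move: (sep _ c0); case: g {Se} => H0; rewrite mulrz_pm => H1.
    rewrite -(sep _ c1) (eqI _ (y (end_node h1) - y v)) ?eqxx //.
    by rewrite opprB addrA subrK.
  rewrite (eqI _ (- (y (end_node h1) + y v))) ?INE; first by case: (_ \in I).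
  by move: H1; rewrite !opprK addrACA addNr addr0.
move=> /(_ a eT erefl); rewrite -ha => yI _.
have /cv/conn : end_edge h0 = e by apply/eqP; rewrite He eqxx.
case/orP => H; case/negP: yv.
  by rewrite -(eqI _ _ (_ : y (end_node h0) - y v \in I)).
by rewrite -INE -(eqI (y (end_node h0))) // opprK.
Qed.

End Components.

(** * The rank of the incidence matrix *)

Lemma sum_enum_rank (R : zmodType) (I : finType) (F : 'I_#|I| -> R) :
  \sum_i F i = \sum_x F (enum_rank x).
Proof. exact: (reindex _ (onW_bij _ (@enum_rank_bij I))). Qed.

Section Rank.
Variables (V E : finType) (S : signed_graph V E).
Variables (o : arrows S) (o_or : is_orientation o).
Variable F : numFieldType.
Implicit Types (e : E) (v : V) (T C : {set E}).

Local Notation root T := (fingraph.root (adj S T)).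

(** The hypothesis says that M has the same left kernel as the incidence matrix
    of T. *)
Lemma rank_incidence T n (M : 'M[F]_(#|V|, n)) :
    (forall y : 'rV_#|V|, (y *m M == 0) =
       [forall e in T, \sum_v y 0 (enum_rank v) *~ incidence o v e == 0]) ->
  \rank M = bias_rank S T.
Proof.
move=> HM; have [s [s_root s_pot]] := exists_component_potential S T.
set R := balanced_roots S T.
(* The rows of P are the potentials of the balanced components; Q reads off the
   values at the roots. *)
pose P : 'M[F]_(#|R|, #|V|) := \matrix_(k, i)
  if balanced_at S T (enum_val i) then
    (root T (enum_val i) == enum_val k)%:R *~ pm (s (enum_val i)) else 0.
pose Q : 'M[F]_(#|V|, #|R|) := \matrix_(i, k) (enum_val i == enum_val k)%:R.
have PQ : P *m Q = 1%:M.
  apply/matrixP=> k l; rewrite !mxE (bigD1 (enum_rank (enum_val l))) //= big1.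
    rewrite !mxE !enum_rankK eqxx mulr1 addr0.
    have lR := enum_valP l; rewrite (balanced_roots_id lR) s_root // mulr1z.
    by rewrite -root_balanced_roots (balanced_roots_id lR) lR eq_sym (inj_eq enum_val_inj).
  move=> i ni; rewrite [Q _ _]mxE; case: eqP => [il|_]; last by rewrite mulr0.
  by rewrite -il enum_valK eqxx in ni.
have PM : P *m M = 0.
  apply/row_matrixP=> k; rewrite row_mul row0; apply/eqP; rewrite HM.
  apply/forall_inP => e eT.
  rewrite -[X in _ == X](potential_in_kernel o_or s_pot
     (fun r => (r == enum_val k)%:R : F) eT); apply/eqP.
  by apply: eq_bigr => v _; rewrite !mxE enum_rankK.
have kerP : (kermx M <= P)%MS.
  apply/rV_subP => y /sub_kermxP/eqP; rewrite HM => /forall_inP Hy.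
  have -> : y = y *m Q *m P; last by rewrite submxMl.
  apply/rowP=> i; rewrite mxE.
  have := kernel_potential o_or s_root s_pot (I := pred1 (0 : F))
    (y := fun v => y 0 (enum_rank v)) _ _ _ (enum_val i).
  rewrite enum_valK !inE subr_eq0 => /(_ _ _ _)/eqP->; first last.
  - exact: Hy.
  - by move=> x; rewrite !inE -mulr2n mulrn_eq0.
  - by split=> [|a b]; rewrite !inE // => /eqP-> /eqP->; rewrite subrr.
  have yQ k : (y *m Q) 0 k = y 0 (enum_rank (enum_val k)).
    rewrite mxE (bigD1 (enum_rank (enum_val k))) //= big1 ?mxE ?enum_rankK ?eqxx.
      by rewrite mulr1 addr0.
    move=> j nj; rewrite mxE; case: eqP => [jk|_]; last by rewrite mulr0.
    by rewrite -jk enum_valK eqxx in nj.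
  case bi: (balanced_at S T (enum_val i)); last first.
    by rewrite big1 // => k _; rewrite [P _ _]mxE bi mulr0.
  have rR : root T (enum_val i) \in R by rewrite root_balanced_roots.
  rewrite (bigD1 (enum_rank_in rR (root T (enum_val i)))) //= big1.
    by rewrite yQ [P _ _]mxE bi enum_rankK_in // eqxx addr0 -[true%:R]/(1 : F) mulrzr.
  move=> k nk; rewrite [P _ _]mxE bi; case: eqP => [rk|_]; last by rewrite mul0rz mulr0.
  by case/eqP: nk; apply: enum_val_inj; rewrite enum_rankK_in // rk.
have rP : \rank P = #|R|.
  apply/eqP; rewrite eqn_leq rank_leq_row -[X in (X <= _)%N](mxrank1 F).
  by rewrite -PQ mxrankM_maxl.
have rK : \rank (kermx M) = #|R|.
  apply/eqP; rewrite -rP eqn_leq !mxrankS //.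
  exact/sub_kermxP.
rewrite /bias_rank nb_balancedE -/R -rK mxrank_ker subKn //.
exact: rank_leq_row.
Qed.

(** The transpose of the incidence matrix: flows form its left kernel. *)
Definition flow_mx : 'M[F]_(#|E|, #|V|) :=
  \matrix_(i, j) (incidence o (enum_val j) (enum_val i))%:~R.

(** Its rows are the unit vectors of the edges of T. *)
Definition support_mx T : 'M[F]_(#|T|, #|E|) :=
  \matrix_(k, i) (enum_val i == enum_val k)%:R.

Lemma support_mxP T (x : 'rV_#|E|) :
  reflect (forall e, e \notin T -> x 0 (enum_rank e) = 0) (x <= support_mx T)%MS.
Proof.
apply: (iffP submxP) => [[u ->] e eT|Hx].
  rewrite mxE big1 // => k _; rewrite mxE enum_rankK; case: eqP => [ek|_].
    by rewrite ek enum_valP in eT.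
  by rewrite mulr0.
exists (\row_k x 0 (enum_rank (enum_val k))); apply/rowP=> i; rewrite mxE.
have [iT|niT] := boolP (enum_val i \in T); last first.
  rewrite -[i]enum_valK Hx // big1 // => k _; rewrite !mxE enum_valK.
  case: eqP => [ik|_]; last by rewrite mulr0.
  by rewrite ik enum_valP in niT.
rewrite (bigD1 (enum_rank_in iT (enum_val i))) //= big1.
  by rewrite !mxE enum_rankK_in // eqxx mulr1 addr0 enum_valK.
move=> k nk; rewrite !mxE; case: eqP => [ik|_]; last by rewrite mulr0.
by case/eqP: nk; apply: enum_val_inj; rewrite enum_rankK_in // ik.
Qed.

Lemma rank_support_mx T : \rank (support_mx T) = #|T|.
Proof.
apply/eqP; rewrite eqn_leq rank_leq_row -[X in (X <= _)%N](mxrank1 F).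
have -> : 1%:M = support_mx T *m (support_mx T)^T; last by rewrite mxrankM_maxl.
apply/matrixP=> k l; rewrite !mxE (bigD1 (enum_rank (enum_val k))) //= big1.
  by rewrite !mxE !enum_rankK eqxx mul1r addr0 (inj_eq enum_val_inj).
move=> i ni; rewrite mxE; case: eqP => [ik|_]; last by rewrite mul0r.
by rewrite -ik enum_valK eqxx in ni.
Qed.

Lemma rank_support_flow_mx T : \rank (support_mx T *m flow_mx) = bias_rank S T.
Proof.
rewrite -mxrank_tr; apply: rank_incidence => y.
rewrite -(inj_eq (@trmx_inj _ _ _)) trmx_mul trmxK trmx0.
have yE k : (support_mx T *m flow_mx *m y^T) k 0 =
    \sum_v y 0 (enum_rank v) *~ incidence o v (enum_val k).
  rewrite mxE sum_enum_rank; apply: eq_bigr => v _.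
  rewrite !mxE (bigD1 (enum_rank (enum_val k))) //= big1 ?addr0.
    by rewrite !mxE !enum_rankK eqxx mul1r mulrzl.
  move=> i ni; rewrite mxE; case: eqP => [ik|_]; last by rewrite mul0r.
  by rewrite -ik enum_valK eqxx in ni.
apply/eqP/forall_inP => [H e eT|H].
  by rewrite -(enum_rankK_in eT eT) -yE H mxE.
by apply/colP=> k; rewrite yE mxE; apply/eqP/H/enum_valP.
Qed.

Lemma bias_rank_le_card_oriented T : (bias_rank S T <= #|T|)%N.
Proof. by rewrite -rank_support_flow_mx rank_leq_row. Qed.

Lemma rank_flow_mx : \rank flow_mx = bias_rank S [set: E].
Proof.
rewrite -rank_support_flow_mx; apply/eqP; rewrite eqn_leq mxrankM_maxr andbT.
apply: mxrankS; apply/row_subP => i; rewrite rowE; apply: submxMr.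
by apply/support_mxP => e; rewrite inE.
Qed.

Lemma bias_rank_le_setT_oriented T : (bias_rank S T <= bias_rank S [set: E])%N.
Proof. by rewrite -rank_flow_mx -rank_support_flow_mx mxrankM_maxr. Qed.

(** The dimension of the space of flows supported in T. *)
Lemma rank_flow_space T :
  \rank (support_mx T :&: kermx flow_mx)%MS = (#|T| - bias_rank S T)%N.
Proof.
have := mxrank_mul_ker (support_mx T) flow_mx.
rewrite rank_support_mx rank_support_flow_mx => /(congr1 (subn^~ (bias_rank S T))).
by rewrite addKn.
Qed.

(** x is a flow for the orientation o. *)
Definition is_flow (x : E -> F) : Prop :=
  forall v, \sum_e x e *~ incidence o v e = 0.

Lemma flow_kermxP (x : 'rV_#|E|) :
  reflect (is_flow (fun e => x 0 (enum_rank e))) (x <= kermx flow_mx)%MS.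
Proof.
have xE v : (x *m flow_mx) 0 (enum_rank v) = \sum_e x 0 (enum_rank e) *~ incidence o v e.
  rewrite mxE sum_enum_rank; apply: eq_bigr => e _.
  by rewrite mxE !enum_rankK mulrzr.
apply: (iffP sub_kermxP) => [H v|H]; first by rewrite -xE H mxE.
by apply/rowP=> j; rewrite -[j]enum_valK xE H mxE.
Qed.

(** The dependent sets of the bias matroid are those that support a
    nonzero flow. *)
Lemma dependentP T :
  reflect (exists x : E -> F, [/\ is_flow x, (forall e, e \notin T -> x e = 0)
                               & exists e, x e != 0])
          (bias_rank S T < #|T|)%N.
Proof.
rewrite -subn_gt0 -rank_flow_space lt0n mxrank_eq0.
apply: (iffP rowV0Pn) => [[x]|[x [xf xT [e xe]]]].
  rewrite sub_capmx => /andP[/support_mxP xT /flow_kermxP xf] x0.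
  exists (fun e => x 0 (enum_rank e)); split=> //.
  case/rV0Pn: x0 => i xi; exists (enum_val i); by rewrite enum_valK.
have xE a : (\row_i x (enum_val i)) 0 (enum_rank a) = x a by rewrite mxE enum_rankK.
exists (\row_i x (enum_val i)).
  rewrite sub_capmx; apply/andP; split.
    by apply/support_mxP => a /xT; rewrite xE.
  by apply/flow_kermxP => v; rewrite -[RHS](xf v); apply: eq_bigr => a _; rewrite xE.
by apply/rV0Pn; exists (enum_rank e); rewrite xE.
Qed.

End Rank.

Section ReferenceOrientation.
Variables (V E : finType) (S : signed_graph V E).

Lemma exists_orientation : exists o : arrows S, is_orientation o.
Proof.
pose up (h : edge_end S) := ~~ (val h).2 || (edge_sign S (end_edge h) != 1).
exists ([ffun h => up h], [ffun=> true]).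
apply/forallP => h1; apply/forallP => h2; apply/implyP => /andP[ne /eqP eh].
rewrite !ffunE /up -eh; have : (val h1).2 != (val h2).2.
  apply: contraNneq ne => e2; apply/eqP/val_inj; move: eh e2; rewrite /end_edge.
  by case: (val h1) => ? ?; case: (val h2) => ? ? /= -> ->.
rewrite /edge_sign; move: eh; rewrite /end_edge.
have := valP h1; have := valP h2; rewrite /endpoint.
case: (val h1) => e1 i1; case: (val h2) => e2 i2 /= + + e12; rewrite -e12.
case: (S e1) => [u v g _ _|u|//]; last by case: i1; case: i2.
by case: i1; case: i2; case: g.
Qed.

Lemma bias_rank_le_card T : (bias_rank S T <= #|T|)%N.
Proof. by have [o oo] := exists_orientation; apply: (bias_rank_le_card_oriented oo rat). Qed.

Lemma bias_rank_le_setT T : (bias_rank S T <= bias_rank S [set: E])%N.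
Proof. by have [o oo] := exists_orientation; apply: (bias_rank_le_setT_oriented oo rat). Qed.

End ReferenceOrientation.

(** * Flows with values in a finite group of odd order *)

Lemma mulrn_card (A : finZmodType) (x : A) : x *+ #|A| = 0.
Proof.
apply: (addIr (\sum_(y : A) y)).
rewrite add0r [RHS](reindex_inj (addrI x)) big_split /=.
by rewrite sumr_const.
Qed.

(** A form of Lagrange's theorem, for a subset X closed under subtraction. *)
Lemma card_image_kernel (I J : finType) (A B : finZmodType)
    (f : {ffun I -> A} -> {ffun J -> B}) (X : {set {ffun I -> A}}) :
    {morph f : x y / x - y} -> (forall x y, x \in X -> y \in X -> x - y \in X) ->
  #|X| = (#|f @: X| * #|[set x in X | f x == 0%R]|)%N.
Proof.
move=> fB XB; rewrite -sum1_card (partition_big_imset f) /= -sum_nat_const.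
apply: eq_bigr => _ /imsetP[x0 Xx0 ->].
have XN x : x \in X -> - x \in X.
  by move=> Xx; rewrite -sub0r XB // -(subrr x) XB.
rewrite sum1dep_card -(card_imset _ (addIr (- x0))).
apply: eq_card => x; rewrite inE; apply/imsetP/andP => [[z]|[Xx /eqP fx]].
  by rewrite inE => /andP[Xz /eqP fz] ->; rewrite XB // fB fz subrr.
exists (x + x0); last by rewrite addrK.
have XD : x + x0 \in X by rewrite -[x0]opprK XB ?XN.
rewrite inE XD; apply/eqP; have f0 : f 0 = 0 by rewrite -(subrr 0) fB subrr.
by rewrite -{1}[x0]opprK fB -[- x0]sub0r fB fx f0 !sub0r opprK.
Qed.

Section GroupFlows.
Variables (V E : finType) (S : signed_graph V E).
Variables (o : arrows S) (o_or : is_orientation o).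
Variable A : finZmodType.
Hypothesis A_odd : odd #|A|.
Implicit Types (e : E) (v : V) (T : {set E}).

Local Notation root T := (fingraph.root (adj S T)).

(** The incidence matrix as a map on A-valued functions. *)
Definition boundary (x : {ffun E -> A}) : {ffun V -> A} :=
  [ffun v => \sum_e x e *~ incidence o v e].

(** The A-valued functions that vanish outside X. *)
Definition supported (I : finType) (X : {set I}) : {set {ffun I -> A}} :=
  [set x : {ffun I -> A} | [forall i, (i \notin X) ==> (x i == 0)]].

Lemma supportedP (I : finType) (X : {set I}) (x : {ffun I -> A}) :
  reflect (forall i, i \notin X -> x i = 0) (x \in supported X).
Proof.
rewrite inE; apply: (iffP forallP) => H i; first by move/(implyP (H i))/eqP.
by apply/implyP => /H->.
Qed.

Lemma card_supported (I : finType) (X : {set I}) : #|supported X| = (#|A| ^ #|X|)%N.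
Proof.
rewrite -(card_pffun_on (0 : A) (mem X) predT); apply: eq_card => x.
apply/supportedP/pffun_onP => [H|[/subsetP H _] i iX].
  split; last by move=> y _.
  by apply/subsetP => i; rewrite inE; apply: contraNT => /H->.
by apply: contraNeq iX => xi; apply: H; rewrite inE.
Qed.

Lemma supportedB (I : finType) (X : {set I}) (x y : {ffun I -> A}) :
  x \in supported X -> y \in supported X -> x - y \in supported X.
Proof.
move=> /supportedP Hx /supportedP Hy; apply/supportedP => i iX.
by rewrite !ffunE Hx // Hy // subrr.
Qed.

Lemma boundaryB : {morph boundary : x y / x - y}.
Proof.
move=> x y; apply/ffunP=> v; rewrite !ffunE -sumrB; apply: eq_bigr => e _.
by rewrite !ffunE mulrzBl.
Qed.

(** The function with value a at i and 0 elsewhere. *)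
Definition single (I : finType) (i : I) (a : A) : {ffun I -> A} :=
  [ffun j => if j == i then a else 0].

Lemma sum_single (I : finType) (x : {ffun I -> A}) : x = \sum_i single i (x i).
Proof.
apply/ffunP=> j; rewrite sum_ffunE (bigD1 j) //= big1 ?addr0 ?ffunE ?eqxx //.
by move=> i; rewrite ffunE eq_sym => /negPf->.
Qed.

Section Image.
Variables (T : {set E}) (s : V -> bool).
Hypothesis s_root : forall r, r \in balanced_roots S T -> s r.
Hypothesis s_pot : forall h : edge_end S, end_edge h \in T ->
  balanced_at S T (end_node h) -> consistent S s (end_edge h).

(** The projection to the functions supported on the roots of the balanced
    components, obtained by pushing all values along the potential s. *)
Definition push (z : {ffun V -> A}) : {ffun V -> A} :=
  \sum_v (if balanced_at S T v then single (root T v) (z v *~ pm (s v)) else 0).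

Lemma pushB : {morph push : x y / x - y}.
Proof.
move=> x y; rewrite /push -sumrB; apply: eq_bigr => v _.
case: ifP => _; last by rewrite subr0.
by apply/ffunP=> w; rewrite !ffunE; case: eqP => _; rewrite ?subr0 // mulrzBl.
Qed.

Lemma image_push : push @: [set: {ffun V -> A}] = supported (balanced_roots S T).
Proof.
apply/setP=> z; apply/imsetP/supportedP => [[x _ ->] v vR|zR].
  rewrite sum_ffunE big1 // => w _; case: ifP => [bw|_]; last by rewrite ffunE.
  by rewrite ffunE; case: eqP => // vw; rewrite vw root_balanced_roots bw in vR.
exists z => //; rewrite {1}[z]sum_single /push; apply: eq_bigr => v _.
have [vR|vR] := boolP (v \in balanced_roots S T).
  by rewrite -root_balanced_roots (balanced_roots_id vR) vR s_root.
rewrite zR // mul0rz; case: ifP => _; last by apply/ffunP=> w; rewrite !ffunE if_same.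
by apply/ffunP=> w; rewrite !ffunE !if_same.
Qed.

Lemma push_boundary x : x \in supported T -> push (boundary x) = 0.
Proof.
move=> /supportedP xT; apply/ffunP=> w; rewrite sum_ffunE ffunE.
pose c e r := if w == r then x e else 0.
transitivity (\sum_v \sum_e
    (if balanced_at S T v then c e (root T v) *~ pm (s v) else 0)
      *~ incidence o v e).
  apply: eq_bigr => v _; case: ifP => bv; last first.
    by rewrite ffunE big1 // => e _; rewrite mul0rz.
  rewrite /c !ffunE; case: eqP => _; last by rewrite big1 // => e _; rewrite !mul0rz.
  by rewrite mulrz_suml; apply: eq_bigr => e _; rewrite -!mulrzA mulrC.
rewrite exchange_big big1 // => e _; have [eT|eT] := boolP (e \in T).
  exact: potential_in_kernel.
rewrite big1 // => v _; rewrite /c xT // if_same mul0rz if_same mul0rz.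
by [].
Qed.

(** Every z is congruent to its projection modulo the boundaries: apply
    [kernel_potential], modulo the subgroup of boundaries, to the functions with a
    single nonzero value. *)
Lemma sub_push_image z : z - push z \in boundary @: supported T.
Proof.
have I0 : 0 \in boundary @: supported T.
  apply/imsetP; exists 0; first by apply/supportedP => e _; rewrite ffunE.
  by apply/ffunP=> v; rewrite !ffunE big1 // => e _; rewrite ffunE mul0rz.
have IB x y : x \in boundary @: supported T -> y \in boundary @: supported T ->
    x - y \in boundary @: supported T.
  move=> /imsetP[a aT ->] /imsetP[b bT ->]; rewrite -boundaryB.
  by apply: imset_f; apply: supportedB.
have ID x y : x \in boundary @: supported T -> y \in boundary @: supported T ->
    x + y \in boundary @: supported T.
  by move=> xI yI; rewrite -[y]opprK IB // -sub0r IB.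
have I2 x : x + x \in boundary @: supported T -> x \in boundary @: supported T.
  (* Half of #|A| + 1 is an inverse of 2, as #|A| kills x. *)
  move=> xI; have -> : x = (x + x) *+ (#|A|.+1)./2.
    rewrite -mulr2n -mulrnA mul2n -[(_./2).*2]/(((#|A|.+1)./2).*2)%N.
    rewrite halfK /= A_odd subn0 mulrS; apply/ffunP=> v.
    by rewrite !ffunE ffunMnE mulrn_card addr0.
  by elim: (_./2) => [|n IHn]; rewrite ?mulr0n // mulrS ID.
have Iz : zmod_closed [in boundary @: supported T] by split=> //; apply: IB.
rewrite {1}[z]sum_single /push -sumrB.
apply: (big_ind (fun x => x \in boundary @: supported T)) => [|x y|v _] //; first exact: ID.
have Hy e : e \in T -> \sum_u single u (z v) *~ incidence o u e \in [in boundary @: supported T].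
  move=> eT; apply/imsetP; exists (single e (z v)).
    by apply/supportedP => a aT; rewrite ffunE; case: eqP => // ae; rewrite ae eT in aT.
  apply/ffunP=> w; rewrite !ffunE sum_ffunE (bigD1 w) //= big1 => [|u nu].
    rewrite (bigD1 e) //= big1 => [|a na]; last first.
      by rewrite ffunE (negPf na) mul0rz.
    by rewrite !addr0 !ffunE ?eqxx ffunMzE ffunE eqxx.
  by rewrite ffunMzE ffunE eq_sym (negPf nu) mul0rz.
have := kernel_potential o_or s_root s_pot (y := fun v' => single v' (z v)) Iz I2 Hy v.
have -> : single (root T v) (z v *~ pm (s v)) = single (root T v) (z v) *~ pm (s v).
  apply/ffunP=> w; rewrite !mulrz_pm; case: (s v) => //.
  by rewrite !ffunE; case: eqP => _; rewrite ?oppr0.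
by [].
Qed.

Lemma kernel_push : [set z in [set: {ffun V -> A}] | push z == 0] = boundary @: supported T.
Proof.
apply/setP=> z; rewrite !inE /=; apply/eqP/idP => [z0|/imsetP[x xT ->]].
  by rewrite -[z]subr0 -z0 sub_push_image.
exact: push_boundary.
Qed.

End Image.

(** The number of A-flows supported in T. *)
Lemma card_supported_flows T :
  #|[set x in supported T | boundary x == 0]| = (#|A| ^ (#|T| - bias_rank S T))%N.
Proof.
have [s [s_root s_pot]] := exists_component_potential S T.
have A0 : (0 < #|A|)%N by apply/card_gt0P; exists 0.
have := card_image_kernel (boundaryB) (@supportedB _ T).
have := card_image_kernel (pushB T s) (X := setT) (fun _ _ _ _ => in_setT _).
rewrite image_push // kernel_push // !card_supported cardsT card_ffun.
rewrite -[X in (X ^ _ = _)%N]/(#|A|) => cI cT.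
have cardI : #|boundary @: supported T| = (#|A| ^ bias_rank S T)%N.
  apply/eqP; rewrite -(eqn_pmul2l (m := #|A| ^ #|balanced_roots S T|)) ?expn_gt0 ?A0 //.
  rewrite -cI -expnD /bias_rank nb_balancedE subnKC // max_card //.
apply/eqP; rewrite -(eqn_pmul2l (m := #|A| ^ bias_rank S T)) ?expn_gt0 ?A0 //.
by rewrite -{1}cardI -cT -expnD subnKC ?bias_rank_le_card.
Qed.

End GroupFlows.

(** * Sign vectors of a linear subspace *)

Lemma sum_subsetU1 (R : zmodType) (E : finType) (A : {set E}) i (g : {set E} -> R) :
    i \notin A ->
  \sum_(B : {set E} | B \subset i |: A) g B =
  \sum_(B : {set E} | B \subset A) (g B + g (i |: B)).
Proof.
move=> iA; rewrite big_split /= (bigID (fun B : {set E} => i \in B)) /= addrC.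
congr (_ + _).
  apply: eq_bigl => B; apply/andP/idP => [[BA iB]|BA].
    by rewrite -(setU1K iA) subsetD1 BA.
  split; first exact: subset_trans BA (subsetUr _ _).
  by apply: contra iA => /(subsetP BA).
rewrite (reindex_onto (fun B => i |: B) (fun B => B :\ i)) /=; last first.
  by move=> B /andP[_ iB]; rewrite setD1K.
apply: eq_bigl => B; rewrite setU11 andbT.
apply/andP/idP => [[BA /eqP <-]|BA].
  by rewrite -(setU1K iA); apply: setSD.
have iB : i \notin B by apply: contra iA => /(subsetP BA).
by rewrite setUS // setU1K.
Qed.

Section Cells.
Variables (F : realFieldType) (n : nat) (E : finType) (phi : E -> 'cV[F]_n).
Implicit Types (W : 'M[F]_n) (x : 'rV[F]_n) (A B eps : {set E}).

(** The value of the linear form phi e at x. *)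
Definition lform e x : F := (x *m phi e) 0 0.

Lemma lformD e x y : lform e (x + y) = lform e x + lform e y.
Proof. by rewrite /lform mulmxDl mxE. Qed.

Lemma lformZ e a x : lform e (a *: x) = a * lform e x.
Proof. by rewrite /lform -scalemxAl mxE. Qed.

Lemma lform_ker e x : (x <= kermx (phi e))%MS = (lform e x == 0).
Proof.
apply/sub_kermxP/eqP => [H|H]; first by rewrite /lform H mxE.
by apply/matrixP=> i j; rewrite !ord1 [LHS]H mxE.
Qed.

(** On A, the forms that are positive at x are those in eps, and the other
    ones are negative. *)
Definition in_cell A eps x : Prop :=
  forall e, e \in A -> if e \in eps then 0 < lform e x else lform e x < 0.

(** The cell of eps meets W. *)
Definition realizable W A eps : bool :=
  `[< exists2 x, (x <= W)%MS & in_cell A eps x >].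

(** Cells are open: a point can be moved a little in any direction y. *)
Lemma in_cell_open A eps x y : in_cell A eps x ->
  exists2 d, 0 < d & forall c, `|c| <= d -> in_cell A eps (x + c *: y).
Proof.
move=> Hx; pose K := 1 + \sum_(e in A) `|lform e y| / `|lform e x|.
have K0 : 0 < K.
  by rewrite ltr_pwDl // sumr_ge0 // => e _; rewrite divr_ge0.
exists K^-1; first by rewrite invr_gt0.
move=> c cK e eA; rewrite lformD lformZ.
have xe0 : 0 < `|lform e x|.
  by rewrite normr_gt0; move: (Hx e eA); case: ifP => _; [move/gt_eqF->|move/lt_eqF->].
have small : `|c * lform e y| < `|lform e x|.
  rewrite normrM; apply: le_lt_trans (_ : K^-1 * `|lform e y| < _).
    by rewrite ler_wpM2r.
  rewrite mulrC ltr_pdivrMr // mulrC -ltr_pdivrMr //.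
  rewrite /K (bigD1 e) //= addrCA ltrDl ltr_pwDl // sumr_ge0 // => a _.
  by rewrite divr_ge0.
move: (Hx e eA) small; case: ifP => _ fx.
  by rewrite (gtr0_norm fx) ltr_norml => /andP[+ _]; lra.
by rewrite (ltr0_norm fx) ltr_norml => /andP[_ +]; lra.
Qed.

(** Deletion and restriction of the hyperplane of i, when it does not contain W.
    The two cells on its sides are both realizable exactly if the cell of A meets
    the hyperplane: one way by convexity, the other way because cells are open. *)
Lemma realizableU1 W A eps i : i \notin A -> eps \subset A -> ~~ (W <= kermx (phi i))%MS ->
  (realizable W (i |: A) eps + realizable W (i |: A) (i |: eps))%N =
  (realizable W A eps + realizable (W :&: kermx (phi i))%MS A eps)%N.
Proof.
move=> iA epsA Wi; have iE : i \notin eps by apply: contra iA => /(subsetP epsA).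
have negP' : realizable W (i |: A) eps <->
    exists x, [/\ (x <= W)%MS, in_cell A eps x & lform i x < 0].
  split=> [/asboolP[x xW xA]|[x [xW xA xi]]].
    exists x; split=> // [e eA|]; first by apply: xA; rewrite inE eA orbT.
    by have := xA i; rewrite setU11 (negPf iE) => /(_ isT).
  apply/asboolP; exists x => // e; rewrite !inE => /predU1P[->|/xA//].
  by rewrite (negPf iE).
have posP' : realizable W (i |: A) (i |: eps) <->
    exists x, [/\ (x <= W)%MS, in_cell A eps x & 0 < lform i x].
  split=> [/asboolP[x xW xA]|[x [xW xA xi]]].
    exists x; split=> // [e eA|]; last by have := xA i; rewrite !setU11 => /(_ isT).
    have := xA e; rewrite !inE eA orbT => /(_ isT).
    by case: eqP eA => //= ->; rewrite (negPf iA).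
  apply/asboolP; exists x => // e; rewrite !inE => /predU1P[->|eA].
    by rewrite eqxx.
  by case: eqP eA => [->|_ /xA//]; rewrite (negPf iA).
(* A direction in W that leaves the hyperplane. *)
have [w wW wi] : exists2 w, (w <= W)%MS & 0 < lform i w.
  have [j] : exists j, ~~ (row j W <= kermx (phi i))%MS.
    by apply/existsP; rewrite -negb_forall; apply: contra Wi => /forallP H; apply/row_subP.
  rewrite lform_ker neq_lt => /orP[] H; last by exists (row j W); rewrite ?row_sub.
  exists ((-1) *: row j W); first by rewrite scalemx_sub ?row_sub.
  by rewrite lformZ mulN1r oppr_gt0.
have zeroP : realizable (W :&: kermx (phi i))%MS A eps <->
    realizable W (i |: A) eps /\ realizable W (i |: A) (i |: eps).
  rewrite negP' posP'; split=> [/asboolP[x]|[[x [xW xA xi]] [y [yW yA yi]]]].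
    rewrite sub_capmx lform_ker => /andP[xW /eqP xi] xA.
    have [d d0 Hd] := in_cell_open w xA.
    split; [exists (x + (- d) *: w)|exists (x + d *: w)]; split;
      rewrite ?addmx_sub ?scalemx_sub ?lformD ?lformZ ?xi ?add0r ?mulNr ?oppr_lt0 ?mulr_gt0 //;
      apply: Hd; by rewrite ?normrN gtr0_norm.
  apply/asboolP; exists (lform i y *: x + (- lform i x) *: y).
    rewrite sub_capmx addmx_sub ?scalemx_sub //= lform_ker lformD !lformZ; apply/eqP; ring.
  move=> e eA; rewrite lformD !lformZ; have := xA e eA; have := yA e eA.
  case: ifP => _ ye xe; last rewrite -oppr_gt0 opprD -!mulrN;
    by rewrite addr_gt0 // mulr_gt0 // oppr_gt0.
have anyP : realizable W A eps <->
    realizable W (i |: A) eps \/ realizable W (i |: A) (i |: eps).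
  rewrite negP' posP'; split=> [/asboolP[x xW xA]|]; last first.
    by case=> -[x [xW xA _]]; apply/asboolP; exists x.
  case: (ltgtP (lform i x) 0) => xi; [by left; exists x|by right; exists x|].
  have [d d0 Hd] := in_cell_open w xA; right; exists (x + d *: w).
  rewrite addmx_sub ?scalemx_sub // lformD lformZ xi add0r mulr_gt0 //; split=> //.
  by apply: Hd; rewrite gtr0_norm.
move: zeroP anyP; case: (realizable W _ eps); case: (realizable W _ (_ |: _));
  case: (realizable W A eps); case: (realizable _ A eps) => -[Z1 Z2] [A1 A2] //;
  by [case: (Z1 isT)|case: (Z2 (conj isT isT))|case: (A1 isT)|case: (A2 (or_introl isT))
     |case: (A2 (or_intror isT))|have := Z2 (conj isT isT)
     |have := A2 (or_introl isT)|have := A2 (or_intror isT)].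
Qed.

(** Zaslavsky's count of the regions cut out of W by the hyperplanes of the
    forms in A. *)
Lemma card_cells W A :
  \sum_(eps : {set E} | eps \subset A) ((realizable W A eps : nat)%:Z : int) =
  \sum_(B : {set E} | B \subset A)
     (-1) ^+ (#|B| + \rank W + \rank (W :&: \bigcap_(e in B) kermx (phi e))%MS).
Proof.
move Em: #|A| => m; elim: m A W Em => [|m IHm] A W.
  move/eqP; rewrite cards_eq0 => /eqP->.
  rewrite !(big_pred1 set0) => [|B|B]; rewrite ?subset0 //.
  rewrite big_set0 cards0 add0n capmx1 addnn -mul2n exprM sqrrN !expr1n.
  suff -> : realizable W set0 set0 = true by [].
  by apply/asboolP; exists 0; rewrite ?sub0mx // => e; rewrite inE.
move=> Am; have [i iA] : exists i, i \in A by apply/set0Pn; rewrite -card_gt0 Am.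
rewrite -(setD1K iA); set A' := A :\ i.
have iA' : i \notin A' by rewrite !inE eqxx.
have A'm : #|A'| = m by move: Am; rewrite (cardsD1 i) iA => -[].
rewrite !sum_subsetU1 //.
have capU1 B : B \subset A' -> (W :&: \bigcap_(e in i |: B) kermx (phi e) =
    (W :&: kermx (phi i)) :&: \bigcap_(e in B) kermx (phi e))%MS.
  move=> BA; rewrite big_setU1 ?capmxA //.
  by apply: contra iA' => /(subsetP BA).
have cardU1 B : B \subset A' -> #|i |: B| = #|B|.+1.
  by move=> BA; rewrite cardsU1 (contra _ iA') // => /(subsetP BA).
have [Wi|Wi] := boolP (W <= kermx (phi i))%MS.
  rewrite big1 => [|eps epsA].
    rewrite big1 // => B BA; rewrite capU1 // cardU1 //.
    rewrite (cap_eqmx (capmx_idPl Wi) (eqmx_refl _)).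
    by rewrite !addSn exprS mulN1r subrr.
  suff real0 eps' : realizable W (i |: A') eps' = false by rewrite !real0.
  apply/negP => /asboolP[x xW /(_ i)]; rewrite setU11 => /(_ isT).
  have := submx_trans xW Wi; rewrite lform_ker => /eqP->.
  by case: ifP; rewrite ltxx.
have rk : \rank W = (\rank (W :&: kermx (phi i))%MS).+1.
  rewrite -(mxrank_mul_ker W (phi i)) -[RHS]add1n; congr (_ + _)%N; apply/eqP.
  rewrite eqn_leq rank_leq_col lt0n mxrank_eq0.
  by apply: contra Wi => /eqP/sub_kermxP.
transitivity (\sum_(eps : {set E} | eps \subset A')
    ((realizable W A' eps : nat)%:Z
     + (realizable (W :&: kermx (phi i))%MS A' eps : nat)%:Z)).
  by apply: eq_bigr => eps epsA; rewrite -!PoszD realizableU1.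
rewrite big_split /= !IHm // -big_split; apply: eq_bigr => B BA /=.
rewrite capU1 // cardU1 // rk; congr (_ + _).
by rewrite !addnS !addSn !exprS !mulN1r opprK.
Qed.

End Cells.

(** * Totally cyclic orientations and positive flows *)

Section TotallyCyclic.
Variables (V E : finType) (S : signed_graph V E).
Variables (o : arrows S) (o_or : is_orientation o).
Variable F : realFieldType.
Implicit Types (e : E) (v : V) (T C : {set E}) (h : edge_end S) (x y z : E -> F).

Local Notation is_flow := (is_flow o (F := F)).

Lemma is_flow_sum (I : finType) (x : I -> E -> F) :
  (forall i, is_flow (x i)) -> is_flow (fun e => \sum_i x i e).
Proof.
move=> xf v; rewrite (eq_bigr _ (fun e _ => mulrz_suml _ _ _ _)) exchange_big /=.
by rewrite big1 // => i _; apply: xf.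
Qed.

Lemma is_flow_sub x y a : is_flow x -> is_flow y -> is_flow (fun e => x e - a * y e).
Proof.
move=> xf yf v; under eq_bigr do rewrite mulrzBl -mulrzAr.
by rewrite sumrB xf -mulr_sumr yf mulr0 subrr.
Qed.

Lemma flow_ends x v :
  \sum_e x e *~ incidence o v e =
  \sum_(h : edge_end S | end_node h == v) x (end_edge h) *~ pm (o.1 h).
Proof.
rewrite [RHS](partition_big (@end_edge _ _ S) xpredT) //=.
apply: eq_bigr => e _; rewrite /incidence mulrz_sumr.
rewrite (eq_bigl (fun h => (end_node h == v) && (end_edge h == e))).
  by apply: eq_bigr => h /andP[_ /eqP->].
by move=> h; rewrite end_atE andbC.
Qed.

(** The other end of an edge with two ends; the end itself for a halfedge. *)
Definition opposite h : edge_end S :=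
  odflt h [pick h' | (end_edge h' == end_edge h) && (h' != h)].

Lemma opposite_edge h : end_edge (opposite h) = end_edge h.
Proof. by rewrite /opposite; case: pickP => //= h' /andP[/eqP]. Qed.

(** A halfedge is to be traversed twice, out and back. *)
Lemma sum_opposite (G : edge_end S -> F) h :
  (if opposite h == h then 2 else 1) *
    (\sum_(h' : edge_end S | end_edge h' == end_edge h) G h')
  = G h + G (opposite h).
Proof.
rewrite /opposite; move: {-1}(end_edge h) (erefl (end_edge h)) => e he.
move/eqP: he; case: (edgeP S e) => [u v g h0 h1 _ ne _ _ He|u h0 _ _ He|_ He]; rewrite He //.
- move=> hE; rewrite (big_two_ends _ _ ne He) /=; case: pickP => [h'|H] /=.
    rewrite He => /andP[h'E /[dup] nh /negPf->]; rewrite mul1r.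
    case/orP: hE nh => /eqP->; case/orP: h'E => /eqP-> //; rewrite ?eqxx // => _.
    by rewrite addrC.
  have := H h0; have := H h1; rewrite !He !eqxx orbT /=.
  by case/orP: hE => /eqP ->; rewrite ?eqxx // 1?eq_sym ?ne // eq_sym ne.
- move=> /eqP->; rewrite (big_one_end _ _ He) /=; case: pickP => [h'|_] /=.
    by rewrite He => /andP[->].
  by rewrite eqxx; ring.
Qed.

(** An oriented cycle supports a nonzero nonnegative flow: since no node is a
    source or a sink, one can walk along the arrows for ever, and the flow
    counts the passages of a walk which has become periodic. *)
Lemma nonneg_flow_of_cycle C : oriented_cycle o C ->
  exists y, [/\ is_flow y, (forall e, 0 <= y e), (forall e, e \notin C -> y e = 0)
              & exists e, y e != 0].
Proof.
move=> /andP[Ccirc /forallP Cnss].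
have [h0 h0C|noend] := pickP (fun h => end_edge h \in C); last first.
  exists (fun e => (e \in C)%:R); split.
  - move=> v; rewrite flow_ends big1 // => h _.
    by rewrite noend mul0rz.
  - by move=> e; rewrite ler0n.
  - by move=> e /negPf->.
  have [C0|[e eC]] := set_0Vmem C; last by exists e; rewrite eC oner_neq0.
  by have := minsetp Ccirc; rewrite /= C0 cards0.
have /fin_all_exists[f Hf] : forall h, exists h', end_edge h \in C ->
    [/\ end_edge h' \in C, end_node h' = end_node (opposite h)
      & o.1 h' != o.1 (opposite h)].
  move=> h; have [hC|] := boolP (end_edge h \in C); last by exists h.
  have oC : end_edge (opposite h) \in C by rewrite opposite_edge.
  have := Cnss (end_node (opposite h)); rewrite /is_source_or_sink.
  have -> : (0 < degree S C (end_node (opposite h)))%N.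
    by apply/degree_gt0P; exists (opposite h).
  rewrite negb_or /= !negb_forall => /andP[/existsP[h1 H1] /existsP[h2 H2]].
  move: H1 H2; rewrite !negb_imply !end_atE ?negbK.
  move=> /andP[/andP[h1C /eqP h1v] o1] /andP[/andP[h2C /eqP h2v] o2].
  case oh: (o.1 (opposite h)).
    by exists h1 => _; split=> //; case: (o.1 h1) o1.
  by exists h2 => _; split=> //; case: (o.1 h2) o2.
(* A minimal nonempty set D of ends that is mapped to itself by the walk f; by
   minimality f permutes it. *)
pose closed_ends := fun D : {set edge_end S} =>
  [&& D != set0, D \subset [set h | end_edge h \in C] & f @: D \subset D].
have [D /minsetP[/and3P[/set0Pn[h1 h1D] DC fD] Dmin] _] :
    {D | minset closed_ends D & D \subset [set h | end_edge h \in C]}.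
  apply: minset_exists; apply/and3P; split=> //.
    by apply/set0Pn; exists h0; rewrite inE.
  by apply/subsetP => _ /imsetP[h hC ->]; rewrite !inE in hC *; case: (Hf h hC).
have fDE : f @: D = D.
  apply: Dmin => //; apply/and3P; split.
  - by apply/set0Pn; exists (f h1); apply: imset_f.
  - exact: subset_trans DC.
  - exact: imsetS.
have f_inj : {in D &, injective f} by apply/imset_injP; rewrite fDE.
pose w h : F := if opposite h == h then 2 else 1.
have w0 h : 0 < w h by rewrite /w; case: ifP => _; rewrite ?ltr0n ?ltr01.
exists (fun e => \sum_(h in D | end_edge h == e) w h); split.
- move=> v; pose G h := (end_node h == v)%:R *~ pm (o.1 h) : F.
  (* Leaving through h and arriving through its opposite contribute at v; the
     arrival is cancelled by the next departure f h. *)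
  transitivity (\sum_(h in D) (G h + G (opposite h))).
    rewrite (partition_big (@end_edge _ _ S) xpredT) //=; apply: eq_bigr => e _.
    rewrite mulrz_suml; apply: eq_bigr => h /andP[_ /eqP <-].
    rewrite -sum_opposite -/(w h) -mulrzr; congr (_ * _).
    rewrite /incidence raddf_sum big_mkcondr /=; apply: eq_bigr => h' _.
    by rewrite end_atE /G; case: eqP => _; rewrite ?mul0rz // mulrzr.
  rewrite big_split /= -[X in X + _]/(\sum_(h in D) G h) -{1}fDE big_imset //=.
  rewrite -big_split big1 //= => h hD; rewrite /G.
  have [|_ -> ne] := Hf h; first by have := subsetP DC h hD; rewrite inE.
  by rewrite (pm_neg ne) mulrNz addNr.
- by move=> e; apply: sumr_ge0 => h _; apply: ltW.
- move=> e eC; rewrite big1 // => h /andP[/(subsetP DC)]; rewrite inE => hC /eqP he.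
  by rewrite -he hC in eC.
- exists (end_edge h1); apply: lt0r_neq0; rewrite (bigD1 h1) /= ?h1D ?eqxx //.
  by rewrite ltr_pwDl // sumr_ge0 // => h _; apply: ltW.
Qed.

(** The flow of the previous lemma is positive on all of C, since its support is
    dependent and C is minimal. *)
Lemma positive_flow_of_cycle C : oriented_cycle o C ->
  exists y, [/\ is_flow y, (forall e, 0 <= y e) & forall e, e \in C -> 0 < y e].
Proof.
move=> Ccyc; have [y [yf y0 yC yn]] := nonneg_flow_of_cycle Ccyc.
exists y; split=> // e; have /andP[Ccirc _] := Ccyc.
have <- : [set e | y e != 0] = C.
  apply: (minsetinf Ccirc); last first.
    by apply/subsetP => a; rewrite inE; apply: contraR => /yC->.
  apply/(dependentP o_or F); exists y; split=> // a.
  by rewrite inE negbK => /eqP.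
by rewrite inE lt0r y0 andbT.
Qed.

(** A nonnegative flow through e contains a circuit through e carrying such a
    flow: y is reduced along a flow with smaller support as long as there is one. *)
Lemma circuit_in_flow e y : is_flow y -> (forall a, 0 <= y a) -> 0 < y e ->
  exists2 z, [/\ is_flow z, forall a, 0 <= z a & 0 < z e]
           & bias_circuit S [set a | z a != 0].
Proof.
have [m] := ubnP #|[set a | y a != 0]|; elim: m y => // m IHm y lem yf y0 ye.
set T := [set a | y a != 0] in lem *.
have [Tc|Tn] := boolP (bias_circuit S T); first by exists y.
have Tdep : (bias_rank S T < #|T|)%N.
  apply/(dependentP o_or F); exists y; split=> //; last by exists e; rewrite gt_eqF.
  by move=> a; rewrite inE negbK => /eqP.
have [B /minsetP[Bdep Bmin] BT] :=
  minset_exists (P := fun B : {set E} => (bias_rank S B < #|B|)%N) Tdep.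
have /set0Pn[b] : T :\: B != set0.
  rewrite setD_eq0; apply: contra Tn => TB.
  by have <- : B = T; [apply/eqP; rewrite eqEsubset BT|apply/minsetP].
rewrite !inE => /andP[bB yb].
have /(dependentP o_or F)[u [uf uB [a ua]]] := Bdep.
(* Subtracting a multiple of y makes e drop out of the support of u. *)
pose c := u e / y e; pose z i := u i - c * y i.
have zf : is_flow z by apply: is_flow_sub.
have ze : z e = 0 by rewrite /z /c divfK ?subrr ?gt_eqF.
have yT i : i \notin T -> y i = 0 by rewrite inE negbK => /eqP.
have zT i : i \notin T -> z i = 0.
  move=> iT; rewrite /z yT // uB ?mulr0 ?subrr //.
  by apply: contra iT; apply: subsetP.
have [p zp] : exists p, z p != 0.
  have [c0|c0] := eqVneq c 0; first by exists a; rewrite /z c0 mul0r subr0.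
  by exists b; rewrite /z uB // sub0r oppr_eq0 mulf_neq0.
have [t [tf te tT tp]] : exists t, [/\ is_flow t, t e = 0,
    (forall i, i \notin T -> t i = 0) & 0 < t p].
  move: zp; rewrite neq_lt => /orP[zp|zp]; last by exists z.
  exists (fun i => 0 - 1 * z i); split.
  - by apply: is_flow_sub => // v; rewrite big1 // => i _; rewrite mul0rz.
  - by rewrite ze mulr0 subr0.
  - by move=> i /zT->; rewrite mulr0 subr0.
  - by rewrite mul1r sub0r oppr_gt0.
have [q tq qmin] := arg_minP (P := fun i => 0 < t i) (fun i => y i / t i) tp.
(* The largest multiple of t that can be subtracted keeping y nonnegative. *)
pose l := y q / t q; have l0 : 0 <= l by rewrite divr_ge0 // ltW.
have qT : q \in T by apply: contraTT tq => /tT->; rewrite ltxx.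
have yq : y q - l * t q = 0 by rewrite /l divfK ?subrr ?gt_eqF.
have [||||x] := IHm (fun i => y i - l * t i); last by exists x.
- apply: leq_trans (_ : #|T| <= m)%N => //; apply: proper_card.
  apply/properP; split; last by exists q => //; rewrite inE yq eqxx.
  by apply/subsetP => i; rewrite inE; apply: contraR => iT; rewrite yT // tT // mulr0 subr0.
- exact: is_flow_sub.
- move=> i; rewrite subr_ge0; have [ti|ti] := ltP 0 (t i).
    by rewrite -ler_pdivlMr // qmin.
  by apply: le_trans (y0 i); rewrite mulr_ge0_le0.
- by rewrite te mulr0 subr0.
Qed.

(** A nonnegative flow leaves every node that it enters, so that its support has
    neither source nor sink. *)
Lemma cycle_of_circuit x : is_flow x -> (forall e, 0 <= x e) ->
  bias_circuit S [set e | x e != 0] -> oriented_cycle o [set e | x e != 0].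
Proof.
move=> xf x0 xc; set C := [set e | _] in xc *; apply/andP; split=> //.
apply/forallP => v; apply/negP => /andP[/degree_gt0P[h0 h0C h0v] Hv].
have [b Hb] : exists b, forall h, end_edge h \in C -> end_node h = v -> o.1 h = b.
  case/orP: Hv => /forallP Hv; [exists true|exists false] => h hC hv;
    have := Hv h; rewrite end_atE hC hv eqxx // => /negPf//.
have : \sum_(h : edge_end S | end_node h == v) x (end_edge h) = 0.
  have := xf v; rewrite flow_ends.
  have -> : \sum_(h : edge_end S | end_node h == v) x (end_edge h) *~ pm (o.1 h) =
      (\sum_(h : edge_end S | end_node h == v) x (end_edge h)) *~ pm b.
    rewrite mulrz_suml; apply: eq_bigr => h /eqP hv.
    have [hC|] := boolP (end_edge h \in C); first by rewrite (Hb h).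
    by rewrite inE negbK => /eqP->; rewrite !mul0rz.
  by rewrite mulrz_pm; case: b {Hb} => // /eqP; rewrite oppr_eq0 => /eqP.
move/psumr_eq0P => /(_ (fun h _ => x0 (end_edge h)) h0); rewrite h0v eqxx => /(_ isT) x00.
by rewrite inE x00 eqxx in h0C.
Qed.

Lemma totally_cyclicP :
  reflect (exists2 x, is_flow x & forall e, 0 < x e) (totally_cyclic o).
Proof.
apply: (iffP forallP) => [H|[x xf x0] e]; last first.
  have [z [zf z0 ze] zc] := circuit_in_flow xf (fun a => ltW (x0 a)) (x0 e).
  apply/existsP; exists [set a | z a != 0]; rewrite inE gt_eqF //=.
  exact: cycle_of_circuit.
have /fin_all_exists[x Hx] : forall e, exists x,
    [/\ is_flow x, (forall a, 0 <= x a) & 0 < x e].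
  move=> e; have /existsP[C /andP[eC Cc]] := H e.
  by have [x [xf x0 xC]] := positive_flow_of_cycle Cc; exists x; split=> //; apply: xC.
exists (fun e => \sum_a x a e); first by apply: is_flow_sum => a; case: (Hx a).
move=> e; rewrite (bigD1 e) //= ltr_pwDl //; first by case: (Hx e).
by apply: sumr_ge0 => a _; case: (Hx a).
Qed.

End TotallyCyclic.

(** * Reorientations *)

Section Reorientation.
Variables (V E : finType) (S : signed_graph V E).
Variables (o0 : arrows S) (o0_or : is_orientation o0).
Implicit Types (e : E) (v : V) (eps B T : {set E}).

(** The orientation that agrees with o0 on the edges of eps and is opposite to
    it on the other ones; a loose edge is oriented by whether it lies in eps. *)
Definition reorient eps : arrows S :=
  ([ffun h => o0.1 h (+) (end_edge h \notin eps)], [ffun l => val l \in eps]).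

Lemma reorient_is_orientation eps : is_orientation (reorient eps).
Proof.
apply/forallP => h1; apply/forallP => h2; apply/implyP => hh.
have /forallP/(_ h1)/forallP/(_ h2)/implyP/(_ hh) := o0_or.
case/andP: hh => _ /eqP hh; rewrite /= !ffunE -hh.
by case: (_ \in eps); rewrite /= ?addbF ?addbT ?pmN ?mulrNN.
Qed.

Lemma end_not_loose (h : edge_end S) : ~~ is_loose S (end_edge h).
Proof. by rewrite /is_loose; case: edgeP (erefl (end_edge h)) => // _ He /eqP; rewrite He. Qed.

Lemma loose_not_end e (h : edge_end S) : is_loose S e -> end_edge h != e.
Proof. by move=> le; apply: contraTneq le => <-; apply: end_not_loose. Qed.

Lemma exists_end e : ~~ is_loose S e -> exists h : edge_end S, end_edge h = e.
Proof.
rewrite /is_loose; case: edgeP => [u v g h0 h1 _ _ _ _ He|u h0 _ _ He|//] _;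
  by exists h0; apply/eqP; rewrite He eqxx.
Qed.

Lemma reorient_inj : injective reorient.
Proof.
move=> eps eps' [/ffunP H1 /ffunP H2]; apply/setP=> e.
have [le|le] := boolP (is_loose S e).
  by have := H2 (exist _ e le); rewrite !ffunE.
have [h he] := exists_end le.
by have := H1 h; rewrite !ffunE he => /addbI/negb_inj.
Qed.

Lemma reorient_surj o : is_orientation o -> exists eps, o = reorient eps.
Proof.
move=> oor; pose agree e := [forall h : edge_end S, (end_edge h == e) ==> (o.1 h == o0.1 h)].
exists [set e | agree e && (if insub e is Some l then o.2 l else true)].
have agreeE (h h' : edge_end S) : end_edge h' = end_edge h ->
    (o.1 h' == o0.1 h') = (o.1 h == o0.1 h).
  move=> hh; have [->//|ne] := eqVneq h' h.
  have /forallP/(_ h')/forallP/(_ h)/implyP := oor.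
  have /forallP/(_ h')/forallP/(_ h)/implyP := o0_or.
  rewrite ne hh eqxx => /(_ isT)/eqP-> /(_ isT).
  by case: (o.1 h'); case: (o.1 h); case: (o0.1 h'); case: (o0.1 h).
case: o oor @agree agreeE => o1 o2 /= _ agreeE; congr pair; apply/ffunP.
  move=> h; rewrite ffunE inE insubN ?end_not_loose // andbT.
  have -> : [forall h' : edge_end S, (end_edge h' == end_edge h) ==> (o1 h' == o0.1 h')]
     = (o1 h == o0.1 h).
    apply/forallP/idP => [/(_ h)|H h']; first by rewrite eqxx.
    by apply/implyP => /eqP/agreeE->.
  by case: (o1 h); case: (o0.1 h).
move=> l; rewrite ffunE inE valK.
have -> : [forall h' : edge_end S, (end_edge h' == val l) ==> (o1 h' == o0.1 h')] = true => //.
by apply/forallP => h; rewrite (negPf (loose_not_end h (valP l))).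
Qed.

Lemma incidence_reorient eps v e :
  incidence (reorient eps) v e = incidence o0 v e * pm (e \in eps).
Proof.
rewrite /incidence mulr_suml; apply: eq_bigr => h /andP[/eqP he _].
rewrite /= ffunE he; case: (_ \in eps) => /=; rewrite ?addbF ?addbT ?pmN.
  by rewrite mulr1.
by rewrite mulrN1.
Qed.

(** The linear form reading off the value on e. *)
Definition coordinate (F : fieldType) e : 'cV[F]_#|E| := delta_mx (enum_rank e) 0.

Lemma lform_coordinate (F : realFieldType) e (x : 'rV[F]_#|E|) :
  lform (@coordinate F) e x = x 0 (enum_rank e).
Proof.
rewrite /lform /coordinate mxE (bigD1 (enum_rank e)) //= big1 ?mxE ?eqxx ?mulr1 ?addr0 //.
by move=> i ni; rewrite !mxE (negPf ni) mulr0.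
Qed.

(** Positive flows of the reorientation are, up to signs, the flows of o0 with
    sign vector eps. *)
Lemma totally_cyclic_reorient eps :
  totally_cyclic (reorient eps) =
  realizable (@coordinate rat) (kermx (flow_mx o0 rat)) [set: E] eps.
Proof.
apply/(totally_cyclicP (reorient_is_orientation eps) rat)/asboolP.
  case=> x xf x0; pose y : 'rV[rat]_#|E| := \row_i (x (enum_val i) *~ pm (enum_val i \in eps)).
  have yE e : y 0 (enum_rank e) = x e *~ pm (e \in eps) by rewrite mxE enum_rankK.
  exists y.
    apply/flow_kermxP => v; rewrite -[RHS](xf v); apply: eq_bigr => e _.
    by rewrite yE incidence_reorient -mulrzA mulrC.
  move=> e _; rewrite lform_coordinate yE mulrz_pm.
  by case: ifP => ->; rewrite ?oppr_lt0 x0.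
case=> x /flow_kermxP xf x0.
exists (fun e => x 0 (enum_rank e) *~ pm (e \in eps)).
  move=> v; rewrite -[RHS](xf v); apply: eq_bigr => e _.
  by rewrite incidence_reorient -mulrzA mulrCA pm_sqr mulr1.
move=> e; have := x0 e (in_setT e); rewrite lform_coordinate mulrz_pm.
by case: ifP => // _; rewrite oppr_gt0.
Qed.

Lemma card_totally_cyclic :
  #|totally_cyclic_orientations S|%:Z =
  \sum_(eps : {set E} | eps \subset [set: E])
     (realizable (@coordinate rat) (kermx (flow_mx o0 rat)) [set: E] eps : nat)%:Z.
Proof.
have -> : totally_cyclic_orientations S =
    reorient @: [set eps | totally_cyclic (reorient eps)].
  apply/setP=> o; rewrite inE; apply/andP/imsetP => [[/reorient_surj[eps ->] tc]|[eps]].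
    by exists eps; rewrite ?inE.
  by rewrite inE => tc ->; rewrite reorient_is_orientation.
rewrite card_imset; last exact: reorient_inj.
rewrite -sum1dep_card big_mkcond /= (big_morph Posz PoszD (erefl _)).
rewrite [RHS](eq_bigl xpredT) => [|eps]; last exact: subsetT.
apply: eq_bigr => eps _; rewrite totally_cyclic_reorient.
by case: (realizable _ _ _ _).
Qed.

(** The flows that vanish on B are those supported in its complement. *)
Lemma rank_flows_vanishing (F : realFieldType) B :
  \rank (kermx (flow_mx o0 F) :&: \bigcap_(e in B) kermx (coordinate F e))%MS =
  (#|~: B| - bias_rank S (~: B))%N.
Proof.
rewrite -(rank_flow_space o0_or F); apply/eqmx_rank/andP; split;
  apply/rV_subP => x; rewrite !sub_capmx => /andP[].
  move=> -> /sub_bigcapmxP H; rewrite andbT; apply/support_mxP => e.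
  by rewrite inE negbK => /H; rewrite lform_ker lform_coordinate => /eqP.
move=> /support_mxP H ->; apply/sub_bigcapmxP => e eB.
by rewrite lform_ker lform_coordinate H // inE eB.
Qed.

End Reorientation.

(** * The modular flow polynomial *)

Section FlowPolynomial.
Variables (V E : finType) (S : signed_graph V E).

Lemma cyclomaticE : cyclomatic S = (#|E| - bias_rank S [set: E])%N%:Z.
Proof.
have := bias_rank_le_card S [set: E]; rewrite cardsT /cyclomatic /bias_rank.
have : (nb_balanced S [set: E] <= #|V|)%N by rewrite nb_balancedE max_card.
by lia.
Qed.

Lemma modular_flow_polyE (k : int) :
  (modular_flow_poly S).[k] =
  \sum_(T : {set E}) (-1) ^+ #|~: T| * k ^+ (#|T| - bias_rank S T).
Proof.
rewrite /modular_flow_poly /tutte cyclomaticE -exprnP hornerZ horner_sum mulr_sumr.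
apply: eq_bigr => T _; rewrite !hornerE /=.
have -> : 1 - k - 1 = -1 * k by ring.
rewrite exprMn !mulrA -!exprD; congr (_ * _).
set c := (#|T| - _)%N; suff -> : (#|E| - bias_rank S [set: E] +
    (bias_rank S [set: E] - bias_rank S T) + c = #|~: T| + c * 2)%N.
  by rewrite exprD mulnC exprM sqrrN !expr1n mulr1.
have := bias_rank_le_card S T; have := bias_rank_le_card S [set: E].
have := bias_rank_le_setT S T; have := cardsC T; rewrite /c cardsT.
by lia.
Qed.

(** Inclusion-exclusion over the set of edges where a flow vanishes. *)
Lemma nowhere_zero_modular_flows : counts_modular_flows S (modular_flow_poly S).
Proof.
move=> o oor A Aodd; rewrite modular_flow_polyE.
pose flows := [set x : {ffun E -> A} | boundary o x == 0].
have nzE : nowhere_zero_flows A o = [set x in flows | [forall e, x e != 0]].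
  apply/setP=> x; rewrite !inE; congr (_ && _).
  apply/forallP/eqP => [H|/ffunP H v].
    by apply/ffunP=> v; rewrite !ffunE; apply/eqP.
  by have := H v; rewrite !ffunE => ->.
rewrite nzE -sum1dep_card natr_sum big_mkcondr /=.
transitivity (\sum_(x in flows) \sum_(T : {set E})
   ((-1) ^+ #|~: T| * (x \in supported A T)%:R : int)).
  rewrite exchange_big; apply: eq_bigr => T _ /=.
  rewrite -mulr_sumr; congr (_ * _).
  rewrite -natrX -(card_supported_flows oor Aodd) -sum1dep_card natr_sum.
  rewrite big_mkcond [RHS]big_mkcond; apply: eq_bigr => x _.
  by rewrite [_ \in flows]inE; case: (x \in _); case: (_ == _).
apply: eq_bigr => x _.
transitivity (\prod_e (1 + - ((x e == 0)%:R : int))).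
  rewrite bigA_distr; apply: eq_bigr => T _.
  rewrite (bigID (mem T)) /= [X in _ = X * _]big1 ?mul1r; last by move=> e ->.
  rewrite (eq_bigr (fun e => - ((x e == 0)%:R : int))) => [|e /negPf->//].
  rewrite (eq_bigl (mem (~: T))) => [|e]; last by rewrite /= inE.
  rewrite prodrN; congr (_ * _).
  have [/supportedP xT|] := boolP (x \in supported A T).
    by rewrite big1 // => e; rewrite /= inE => /xT->; rewrite eqxx.
  rewrite inE negb_forall => /existsP[e]; rewrite negb_imply => /andP[eT xe].
  by rewrite (bigD1 e) ?inE //= (negPf xe) mul0r.
have [/forallP H|] := boolP [forall e, x e != 0].
  by rewrite big1 // => e _; rewrite (negPf (H e)) subr0.
rewrite negb_forall => /existsP[e]; rewrite negbK => /eqP xe.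
by rewrite (bigD1 e) //= xe eqxx subrr mul0r.
Qed.

Lemma totally_cyclic_count :
  #|totally_cyclic_orientations S|%:Z
    = (-1) ^ cyclomatic S * (modular_flow_poly S).[-1].
Proof.
have [o oor] := exists_orientation S.
rewrite (card_totally_cyclic oor) card_cells modular_flow_polyE cyclomaticE.
rewrite -exprnP mulr_sumr (reindex_inj (can_inj setCK)) /=.
rewrite (eq_bigl xpredT) => [|T]; last exact: subsetT.
apply: eq_bigr => T _; rewrite (rank_flows_vanishing oor) setCK -!exprD.
rewrite mxrank_ker (rank_flow_mx oor).
by congr (_ ^+ _); lia.
Qed.

End FlowPolynomial.

Theorem corollary4p4 (V E : finType) (S : signed_graph V E) :
  counts_modular_flows S (modular_flow_poly S) /\
  #|totally_cyclic_orientations S|%:Z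
    = (-1) ^ cyclomatic S * (modular_flow_poly S).[-1].
Proof.
by split; [apply: nowhere_zero_modular_flows|apply: totally_cyclic_count].
Qed.
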